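(* Let $\Pi$ be any probability measure on a metric space $(\Omega,d,\mathcal{B}(\Omega))$, and let $P$ be any Markov kernel on $(\Omega,d,\mathcal{B}(\Omega))$ reversible with respect to $\Pi$. Let $\rho\in(0,1)$. The following are equivalent: (i) The Markov operator $P$ has a spectral gap at least $1-\rho$. (ii) For every probability measure $\mu$ on $\Omega$ with $d\mu/d\Pi\in L^2(\Pi)$, there is a constant $C_\mu\in(0,\infty)$ depending on $\mu$ such that for every positive integer $t$, $$\mathcal{W}_{d\wedge1}(\mu P^t,\Pi)\ \le\ C_\mu\rho^t.$$
   Context: $\mathcal{B}(\Omega)$ is the Borel sigma-algebra. $P$ acts on functions by $Pf(x)=\int f(y)P(x,dy)$ and on measures by $\mu P^t(B)=\int P^t(x,B)\,d\mu(x)$, where $P^t$ is the $t$-step kernel. $P$ is said to have a $1-\beta$ spectral gap if $$\beta=\sup_{f\in L^2(\Pi),\ \|f-\int f\,d\Pi\|_{L^2(\Pi)}\ne0}\frac{\|Pf-\int f\,d\Pi\|_{L^2(\Pi)}}{\|f-\int f\,d\Pi\|_{L^2(\Pi)}};$$ a spectral gap at least $1-\rho$ means that this supremum is at most $\rho$. $\mathcal{W}_{d\wedge1}$ is the Wasserstein distance of order 1 with cost $d\wedge1=\min(d,1)$: $\mathcal{W}_{d\wedge1}(\mu,\nu)=\inf_{\Gamma\in\mathcal{C}(\mu,\nu)}\int (d(x,y)\wedge1)\,d\Gamma(x,y)$, where $\mathcal{C}(\mu,\nu)$ is the set of joint probability measures with marginals $\mu$ and $\nu$. The notation $d\mu/d\Pi\in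 L^2(\Pi)$ means $\mu$ is absolutely continuous with respect to $\Pi$ with square-integrable density. *)

(* Defs.v *)
From HB Require Import structures.
From mathcomp Require Import all_boot all_order all_algebra.
From mathcomp Require Import all_classical all_reals all_analysis.

Set Implicit Arguments.
Unset Strict Implicit.
Unset Printing Implicit Defensive.

Import Order.TTheory GRing.Theory Num.Theory.

Local Open Scope classical_set_scope.
Local Open Scope ring_scope.
Local Open Scope ereal_scope.

(* Measurable types of the library are pointed. Asking for a point only excludes
   the empty metric space, on which there is no probability measure. *)
#[short(type="pointedMetricType")]
HB.structure Definition PointedMetric (K : numDomainType) :=
  { M of Metric K M & isPointed M }.

Notation borel T := (g_sigma_algebraType (@open T)).

Section markov_kernels.
Context d (T : measurableType d) (R : realType).
Implicit Types (P Q : R.-pker T ~> T) (mu : probability T R).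

Section kcomp_noparam_probability.
Variables P Q : R.-pker T ~> T.

Let prob_kcomp x : mkcomp_noparam P Q x [set: T] = 1.
Proof.
rewrite /mkcomp_noparam /= /kcomp_noparam.
under eq_integral do rewrite prob_kernel.
by rewrite integral_cst// mul1e prob_kernel.
Qed.

HB.instance Definition _ := Kernel_isProbability.Build _ _ _ _ _
  (mkcomp_noparam P Q) prob_kcomp.

End kcomp_noparam_probability.

Fixpoint kiter P (t : nat) : R.-pker T ~> T :=
  if t is t'.+1 then mkcomp_noparam (kiter P t') P
  else kdirac (@measurable_id _ T setT).

Definition kact mu P (B : set T) : \bar R := \int[mu]_x P x B.

Section kact_probability.
Variables (mu : probability T R) (P : R.-pker T ~> T).

Let kact0 : kact mu P set0 = 0.
Proof. by apply: integral0_eq => x _; rewrite measure0. Qed.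

Let kact_ge0 B : 0 <= kact mu P B.
Proof. by apply: integral_ge0 => x _; exact: measure_ge0. Qed.

Let kact_sigma_additive : semi_sigma_additive (kact mu P).
Proof.
pose mc := kprobability
  (measurable_cst (mu : pprobability T R) : measurable_fun [set: T] _).
exact: (@measure_semi_sigma_additive _ _ _ (mkcomp_noparam mc P point)).
Qed.

HB.instance Definition _ := isMeasure.Build _ _ _ (kact mu P)
  kact0 kact_ge0 kact_sigma_additive.

Let kact_setT : kact mu P [set: T] = 1.
Proof.
rewrite /kact; under eq_integral do rewrite prob_kernel.
by rewrite integral_cst// mul1e; exact: probability_setT.
Qed.

HB.instance Definition _ := Measure_isProbability.Build _ _ _ (kact mu P)
  kact_setT.

End kact_probability.

Definition reversible P (Pi : probability T R) : Prop :=
  forall A B : set T, measurable A -> measurable B ->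
    \int[Pi]_(x in A) P x B = \int[Pi]_(x in B) P x A.

(* For f in L^2(Pi) with Pi invariant under P, f is P(x,.)-integrable for
   Pi-almost every x; the value of the total integral at the other points
   does not affect any L^2(Pi) norm. *)
Definition markov_op P (f : T -> R) (x : T) : \bar R := \int[P x]_y (f y)%:E.

(* The supremum beta such that P has a 1 - beta spectral gap; it is -oo when
   every f in L^2(Pi) is Pi-almost everywhere constant. *)
Definition spectral_beta P (Pi : probability T R) : \bar R :=
  let mean (f : T -> R) := \int[Pi]_x (f x)%:E in
  let dev (f : T -> R) := 'N[Pi]_2%:E[(fun x => (f x)%:E - mean f)] in
  let opdev (f : T -> R) := 'N[Pi]_2%:E[(fun x => markov_op P f x - mean f)] in
  ereal_sup [set opdev f / dev f
            | f in [set f : T -> R | f \in Lfun Pi 2%:E /\ dev f != 0]].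

(* The library's Radon-Nikodym derivative is finite everywhere
   when mu `<< Pi, so fine loses nothing. *)
Definition has_L2_density mu (Pi : probability T R) : Prop :=
  mu `<< Pi /\
  (fine \o Radon_Nikodym (charge_of_finite_measure mu) Pi) \in Lfun Pi 2%:E.

End markov_kernels.

Section wasserstein.
Context (R : realType) (T : pointedMetricType R).
Implicit Types mu nu : probability (borel T) R.

(* Joint laws live on the Borel sigma-algebra of the product space, for which
   the distance is measurable. It agrees with the product of the Borel
   sigma-algebras when T is separable, and may be larger otherwise. *)
Definition is_coupling mu nu
    (Gamma : probability (borel (T * T)%type) R) : Prop :=
  (forall B : set (borel T), measurable B -> Gamma (fst @^-1` B) = mu B) /\
  (forall B : set (borel T), measurable B -> Gamma (snd @^-1` B) = nu B).

Definition wasserstein_min1 mu nu : \bar R :=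
  ereal_inf [set \int[Gamma]_z (Num.min (mdist z.1 z.2) 1%R)%:E
            | Gamma in is_coupling mu nu].

End wasserstein.

(* Main.v *)
Require Import Defs.
From mathcomp Require Import all_boot all_order all_algebra.
From mathcomp Require Import all_classical all_reals all_analysis.
From HB Require Import structures.
From mathcomp Require Import measurable_realfun lra ring.

(** Why the equivalence holds.

    From a spectral gap to convergence.  If mu has a density h in L2(Pi), then
    reversibility gives mu P^t the density P^t h, and the gap, applied t times,
    brings P^t h to within rho^t ||h - 1|| of the constant 1 in L2(Pi)
    ([kact_kiter_density], [gap_iter]).  The maximal coupling of Pi with a law of
    density g puts mass at most ||g - 1|| off the diagonal, and the
    cost min(d, 1) vanishes on the diagonal and is at most 1 elsewhere
    ([wasserstein_le_Lnorm2]).  The coupling has to live on the Borel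
    sigma-algebra of the square, which for a nonseparable space can be larger
    than the product sigma-algebra, so a product measure, which lives on the
    latter, cannot serve as its off-diagonal part.  That part is an iterated
    integral instead, which makes sense because x |-> nu (A_x), the measure of a section of an
    open set A, is lower semicontinuous; a pi-lambda argument extends its
    measurability to Borel sets A ([measurable_section]).

    From convergence to a spectral gap.  Let f be bounded, Lipschitz and of
    mean 0.  For M large, 1 + f / M is the density of a probability, and
    testing the convergence of the chain started from it against f itself gives
    <P^t f, f> <= C rho^t for every t > 0, by the easy half of
    Kantorovich duality ([wasserstein_duality]).  At even times this reads
    ||P^s f||^2 <= C rho^(2 s).  Since P is self-adjoint, ||P^s f||^2 / rho^(2 s)
    is a convex sequence, and a convex sequence that is bounded above cannot
    increase: comparing its first two terms gives ||P f|| <= rho ||f||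
    ([correlation_decay_contraction]), and the constant C has disappeared.
    Bounded Lipschitz functions are dense in L2(Pi)
    ([Lfun2_lipschitz_approximable]) and P contracts L2(Pi), so the inequality
    passes to all of L2(Pi) ([spectral_gap_of_lipschitz]). *)

Set Implicit Arguments.
Unset Strict Implicit.
Unset Printing Implicit Defensive.

Import Order.TTheory GRing.Theory Num.Theory.
Import numFieldNormedType.Exports.
Local Open Scope classical_set_scope.
Local Open Scope ring_scope.
Local Open Scope ereal_scope.

(** * Weighted mixtures of kernels *)

Section mixture.
Import HBNNSimple.
Context d d' (X : measurableType d) (Y : measurableType d') (R : realType).
Variables (m : {measure set X -> \bar R}) (w : X -> R) (k : R.-ker X ~> Y).
Hypotheses (w0 : forall x, (0 <= w x)%R) (mw : measurable_fun [set: X] w).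

(** The kernel k averaged over m with the weight w.  Dirac kernels turn it into
    the measure of density w, the weight 1 into the law m k, and other
    kernels into the two halves of the maximal coupling.  The proofs in
    the signature let the measure structure be inferred from the term. *)
Definition mixture of (forall x, (0 <= w x)%R) & measurable_fun [set: X] w :=
  fun A : set Y => \int[m]_x ((w x)%:E * k x A).

Local Notation mix := (mixture w0 mw).

Let mixture0 : mix set0 = 0.
Proof. by apply: integral0_eq => x _; rewrite measure0 mule0. Qed.

Let mixture_ge0 A : 0 <= mix A.
Proof. by apply: integral_ge0 => x _; rewrite mule_ge0// lee_fin. Qed.

Let measurable_weighted A : measurable A ->
  measurable_fun [set: X] (fun x => (w x)%:E * k x A).
Proof.
move=> mA; apply: emeasurable_funM; first exact/measurable_EFinP.
exact: measurable_kernel.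
Qed.

Let mixture_sigma_additive : semi_sigma_additive mix.
Proof.
move=> F mF tF mUF; rewrite /mixture.
rewrite [X in _ --> X](_ : _ =
    \sum_(i <oo) \int[m]_x ((w x)%:E * k x (F i))); last first.
  rewrite -integral_nneseries//; last first.
  - by move=> n x _; rewrite mule_ge0// lee_fin.
  - by move=> n; exact: measurable_weighted.
  apply: eq_integral => x _.
  by rewrite nneseriesZl// measure_semi_bigcup.
apply: is_cvg_nneseries => n _ _.
by apply: integral_ge0 => x _; rewrite mule_ge0// lee_fin.
Qed.

HB.instance Definition _ := isMeasure.Build _ _ _ mix
  mixture0 mixture_ge0 mixture_sigma_additive.

Let integral_mixture_nnsfun (h : {nnsfun Y >-> R}) :
  \int[mix]_y (h y)%:E = \int[m]_x ((w x)%:E * \int[k x]_y (h y)%:E).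
Proof.
have hE y : (h y)%:E = \sum_(r \in range h) (r * \1_(h @^-1` [set r]) y)%:E.
  by rewrite fimfunE -fsumEFin.
have mh r : measurable_fun [set: Y] (fun y => (r * \1_(h @^-1` [set r]) y)%:E).
  by apply/measurable_EFinP; exact: measurable_funM.
have h0 r y : [set: Y] y -> 0 <= (r * \1_(h @^-1` [set r]) y)%:E.
  by move=> _; exact: nnfun_muleindic_ge0.
have intE (mu : {measure set Y -> \bar R}) :
    \int[mu]_y (h y)%:E = \sum_(r \in range h) (r%:E * mu (h @^-1` [set r])).
  under eq_integral do rewrite hE.
  rewrite ge0_integral_fsum//; apply: eq_fsbigr => r _.
  rewrite (integralZl_indic _ (fun r => h @^-1` [set r]))//; last first.
    by move=> r0; rewrite preimage_nnfun0.
  by rewrite integral_indic// setIT.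
have rk0 r x : 0 <= r%:E * k x (h @^-1` [set r]).
  have [r0|r0] := leP 0%R r; first by rewrite mule_ge0// lee_fin.
  by rewrite preimage_nnfun0// measure0 mule0.
rewrite intE.
under [RHS]eq_integral => x _.
  rewrite intE ge0_mule_fsumr; last by move=> r; exact: rk0.
  over.
rewrite ge0_integral_fsum//; last 2 first.
- move=> r; apply: emeasurable_funM; first exact/measurable_EFinP.
  by apply: measurable_funeM; exact: measurable_kernel.
- by move=> r x _; rewrite mule_ge0 ?lee_fin ?rk0.
apply: eq_fsbigr => r _; rewrite /mixture.
under [RHS]eq_integral do rewrite muleCA.
have [r0|r0] := leP 0%R r.
  rewrite ge0_integralZl//; first exact: measurable_weighted.
  by move=> x _; rewrite mule_ge0// lee_fin.
rewrite preimage_nnfun0// measure0 mule0 integral0_eq// => x _.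
by rewrite measure0 !mule0.
Qed.

(** Both sides are additive and continuous along nondecreasing sequences in f,
    so it is enough to check simple functions. *)
Lemma integral_mixture f : (forall y, 0 <= f y) -> measurable_fun [set: Y] f ->
  \int[mix]_y f y = \int[m]_x ((w x)%:E * \int[k x]_y f y).
Proof.
move=> f0 mf; pose h := nnsfun_approx measurableT mf.
have limE (mu : {measure set Y -> \bar R}) :
    \int[mu]_y (h n y)%:E @[n --> \oo] --> \int[mu]_y f y.
  have -> : \int[mu]_y f y = \int[mu]_y limn (fun n => (h n y)%:E).
    apply: eq_integral => y _; apply/esym/cvg_lim => //.
    exact: cvg_nnsfun_approx.
  apply: cvg_monotone_convergence => //.
  - by move=> n; exact/measurable_EFinP.
  - by move=> n y _; rewrite lee_fin.
  - by move=> y _ a b ab; rewrite lee_fin; exact/lefP/nd_nnsfun_approx.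
have := limE mix.
rewrite (_ : (fun n => _) = fun n =>
    \int[m]_x ((w x)%:E * \int[k x]_y (h n y)%:E)); last first.
  by apply/funext => n; exact: integral_mixture_nnsfun.
move/cvg_unique; apply => //.
have -> : \int[m]_x ((w x)%:E * \int[k x]_y f y) =
    \int[m]_x limn (fun n => (w x)%:E * \int[k x]_y (h n y)%:E).
  apply: eq_integral => x _; apply/esym/cvg_lim => //.
  by apply: cvgeZl => //; exact: limE.
apply: cvg_monotone_convergence => //.
- move=> n; apply: emeasurable_funM; first exact/measurable_EFinP.
  apply: measurable_fun_integral_kernel => //.
  + exact: measurable_kernel.
  + by move=> z; rewrite lee_fin.
  + exact/measurable_EFinP.
- by move=> n x _; rewrite mule_ge0 ?lee_fin// integral_ge0// => y _;
    rewrite lee_fin.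
- move=> x _ a b ab; rewrite lee_wpmul2l ?lee_fin// ge0_le_integral//.
  + by move=> y _; rewrite lee_fin.
  + exact/measurable_EFinP.
  + exact/measurable_EFinP.
  + by move=> y _; rewrite lee_fin; exact/lefP/nd_nnsfun_approx.
Qed.

End mixture.

(** * Reversibility tested on functions *)

Section reversible_kernel.
Context d (T : measurableType d) (R : realType).
Variables (P : R.-pker T ~> T) (Pi : probability T R).

Definition density m w w0 mw : set T -> \bar R :=
  @mixture _ _ T T R m w (kdirac (@measurable_id _ T setT)) w0 mw.

HB.instance Definition _ m w w0 mw := Measure.on (@density m w w0 mw).

Lemma densityE m w w0 mw A : measurable A ->
  @density m w w0 mw A = \int[m]_(x in A) (w x)%:E.
Proof.
move=> mA; rewrite /density /mixture [RHS]integral_mkcond.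
by apply: eq_integral => x _; rewrite epatch_indic.
Qed.

Lemma integral_density m w w0 mw f : (forall x, 0 <= f x) ->
  measurable_fun [set: T] f ->
  \int[@density m w w0 mw]_x f x = \int[m]_x ((w x)%:E * f x).
Proof.
move=> f0 mf; rewrite [LHS]integral_mixture//; apply: eq_integral => x _.
by rewrite /= integral_dirac// diracT mul1e.
Qed.

Lemma measurable_integral_kernel (f : T -> \bar R) : (forall x, 0 <= f x) ->
  measurable_fun [set: T] f -> measurable_fun [set: T] (fun x => \int[P x]_y f y).
Proof.
by move=> f0 mf; apply: measurable_fun_integral_kernel => // U; exact: measurable_kernel.
Qed.

Lemma prob_kernel_fin_num x A : measurable A -> P x A \is a fin_num.
Proof.
move=> mA; rewrite ge0_fin_numE// (le_lt_trans _ (ltry 1))//.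
by rewrite -(@prob_kernel _ _ _ _ _ P x) le_measure ?inE.
Qed.

Lemma measurable_fine_kernel A : measurable A ->
  measurable_fun [set: T] (fun x => fine (P x A)).
Proof. by move=> mA; apply: measurableT_comp => //; exact: measurable_kernel. Qed.

Lemma fine_kernel_ge0 A x : (0 <= fine (P x A))%R.
Proof. exact: fine_ge0. Qed.

Hypothesis revP : reversible P Pi.

(** Reversibility says that two measures agree: with A fixed, the mixture of P
    over A, and the measure of density P(., A).  Integrating f against both
    upgrades one of the two sets to a function. *)
Let integral_indic_kernel (A : set T) (f : T -> \bar R) :
  measurable A -> (forall x, 0 <= f x) -> measurable_fun [set: T] f ->
  \int[Pi]_(x in A) \int[P x]_y f y = \int[Pi]_x (P x A * f x).
Proof.
move=> mA f0 mf.
have i0 x : (0 <= \1_A x :> R)%R by [].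
have mi : measurable_fun [set: T] (\1_A : T -> R) by [].
transitivity (\int[mixture Pi P i0 mi]_y f y).
  rewrite integral_mixture// [LHS]integral_mkcond; apply: eq_integral => x _.
  by rewrite epatch_indic muleC.
transitivity (\int[density Pi (fine_kernel_ge0 A) (measurable_fine_kernel mA)]_y f y).
  apply: eq_measure_integral => B mB _; rewrite /= densityE//.
  transitivity (\int[Pi]_(x in A) P x B).
    rewrite /= /mixture [RHS]integral_mkcond; apply: eq_integral => x _.
    by rewrite epatch_indic muleC.
  rewrite (revP mA mB).
  by apply: eq_integral => x _; rewrite fineK// prob_kernel_fin_num.
rewrite integral_density//; apply: eq_integral => x _.
by rewrite fineK// prob_kernel_fin_num.
Qed.

(** The same comparison of measures, now with the weight g in place of the
    indicator of A, upgrades the second set.  The bound on g keeps the density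
    P g finite. *)
Lemma reversible_integral (g : T -> R) (f : T -> \bar R) (M : R) :
  (forall x, 0 <= g x <= M)%R -> measurable_fun [set: T] g ->
  (forall x, 0 <= f x) -> measurable_fun [set: T] f ->
  \int[Pi]_x ((g x)%:E * \int[P x]_y f y) =
  \int[Pi]_x (f x * \int[P x]_y (g y)%:E).
Proof.
move=> gM mg f0 mf.
have g0 x : (0 <= g x)%R by have /andP[] := gM x.
have Eg0 x : 0 <= (g x)%:E by rewrite lee_fin.
have mEg : measurable_fun [set: T] (EFin \o g) by exact/measurable_EFinP.
pose Pg x := fine (\int[P x]_y (g y)%:E).
have Pg0 x : (0 <= Pg x)%R by apply: fine_ge0; exact: integral_ge0.
have mPg : measurable_fun [set: T] Pg.
  by apply: measurableT_comp => //; exact: measurable_integral_kernel.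
have PgE x : (Pg x)%:E = \int[P x]_y (g y)%:E.
  rewrite fineK// ge0_fin_numE; last exact: integral_ge0.
  apply: (@le_lt_trans _ _ (\int[P x]_y M%:E)).
    apply: ge0_le_integral => //.
    by move=> y _; rewrite lee_fin; have /andP[] := gM y.
  by rewrite integral_cst//= prob_kernel mule1 ltry.
rewrite -(@integral_mixture _ _ _ _ _ Pi g P)//.
transitivity (\int[density Pi Pg0 mPg]_y f y); last first.
  by rewrite integral_density//; apply: eq_integral => x _; rewrite PgE muleC.
apply: eq_measure_integral => B mB _; rewrite /= densityE//.
under [RHS]eq_integral do rewrite PgE.
rewrite integral_indic_kernel//; apply: eq_integral => x _.
by rewrite muleC.
Qed.

Lemma reversible_invariant (f : T -> \bar R) :
  (forall x, 0 <= f x) -> measurable_fun [set: T] f ->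
  \int[Pi]_x \int[P x]_y f y = \int[Pi]_x f x.
Proof.
move=> f0 mf.
have := @reversible_integral (cst 1%R) f 1%R.
move=> /(_ (fun=> ltac:(by rewrite ler01 lexx)) (measurable_cst _) f0 mf).
under eq_integral do rewrite mul1e.
move=> ->; apply: eq_integral => x _.
by rewrite /= integral_cst// prob_kernel !mule1.
Qed.

End reversible_kernel.

(** * The L2 norm of a real-valued function *)

Section L2norm.
Context d (T : measurableType d) (R : realType) (Pi : {measure set T -> \bar R}).

Local Notation N f := ('N[Pi]_2%:E[EFin \o f]).

Lemma sqr_Lnorm2 (f : T -> \bar R) :
  'N[Pi]_2%:E[f] `^ 2 = \int[Pi]_x (`|f x| `^ 2).
Proof. by rewrite poweR_Lnorm. Qed.

Lemma Lnorm2_real (f : T -> R) : N f `^ 2 = \int[Pi]_x (f x ^+ 2)%:E.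
Proof.
rewrite sqr_Lnorm2; apply: eq_integral => x _ /=.
by rewrite powR_mulrn// real_normK// num_real.
Qed.

Lemma ae_eq_Lnorm2 (f g : T -> \bar R) : measurable_fun [set: T] f ->
  measurable_fun [set: T] g -> ae_eq Pi [set: T] f g ->
  'N[Pi]_2%:E[f] = 'N[Pi]_2%:E[g].
Proof.
move=> mf mg fg; rewrite unlock; congr (_ `^ _); apply: ge0_ae_eq_integral => //.
- by apply: (measurableT_comp (measurable_poweR _)); exact: measurableT_comp.
- by apply: (measurableT_comp (measurable_poweR _)); exact: measurableT_comp.
- by move=> x _; exact: poweR_ge0.
- by move=> x _; exact: poweR_ge0.
- by apply: filterS fg => x /[apply] ->.
Qed.

Lemma le_Lnorm2 (f g : T -> \bar R) : measurable_fun [set: T] f ->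
  measurable_fun [set: T] g -> (forall x, `|f x| <= `|g x|) ->
  'N[Pi]_2%:E[f] <= 'N[Pi]_2%:E[g].
Proof.
move=> mf mg fg; rewrite unlock.
have int_ge0 (h : T -> \bar R) : 0 <= \int[Pi]_x (`|h x| `^ 2).
  by apply: integral_ge0 => x _; exact: poweR_ge0.
have mpow (h : T -> \bar R) : measurable_fun [set: T] h ->
    measurable_fun [set: T] (fun x => `|h x| `^ 2).
  by move=> mh; apply: (measurableT_comp (measurable_poweR _)); exact: measurableT_comp.
apply: gt0_ler_poweR; rewrite ?in_itv/= ?leey ?andbT ?int_ge0//.
apply: ge0_le_integral => //.
- by move=> x _; exact: poweR_ge0.
- exact: mpow.
- exact: mpow.
- by move=> x _; rewrite gt0_ler_poweR// ?in_itv/= ?leey ?andbT.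
Qed.

Lemma Lfun2P (f : T -> R) : f \in Lfun Pi 2%:E <->
  measurable_fun [set: T] f /\ N f < +oo.
Proof.
rewrite inE; split; first by case/andP; rewrite !inE.
by move=> [mf Nf]; apply/andP; rewrite !inE.
Qed.

Lemma Lnorm2D (f g : T -> R) : measurable_fun [set: T] f ->
  measurable_fun [set: T] g -> N (f \+ g)%R <= N f + N g.
Proof. by move=> mf mg; apply: minkowski_EFin => //; rewrite ler1n. Qed.

Lemma Lnorm2N (f : T -> R) : N (\- f)%R = N f.
Proof. exact: (oppe_Lnorm Pi (EFin \o f)). Qed.

Lemma Lnorm2B (f g : T -> R) : measurable_fun [set: T] f ->
  measurable_fun [set: T] g -> N (f \- g)%R <= N f + N g.
Proof.
by move=> mf mg; rewrite -(Lnorm2N g); apply: Lnorm2D => //; exact: measurableT_comp.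
Qed.

End L2norm.

Section L2norm_probability.
Context d (T : measurableType d) (R : realType) (Pi : {measure set T -> \bar R}).
Hypothesis Pi1 : Pi [set: T] = 1.
Local Notation N f := ('N[Pi]_2%:E[EFin \o f]).

Lemma Lnorm2_cst (c : R) : N (cst c) = `|c|%:E.
Proof.
rewrite unlock /= integral_cst//= Pi1 mule1 poweR_EFin.
by rewrite -powRrM mulfV// powRr1.
Qed.

(** Hoelder's inequality against the constant 1. *)
Lemma Lnorm1_le2 (f : T -> R) : measurable_fun [set: T] f ->
  \int[Pi]_x `|(f x)%:E| <= N f.
Proof.
move=> mf.
have := @hoelder _ _ _ Pi f (cst 1%R) 2%R 2%R mf (measurable_cst _).
move=> /(_ ltac:(by []) ltac:(by []) ltac:(by rewrite [RHS]splitr !div1r)).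
rewrite Lnorm2_cst normr1 mule1; apply: le_trans.
by rewrite Lnorm1; under [leRHS]eq_integral do rewrite /= mulr1.
Qed.

Lemma abse_integral_le_Lnorm2 (f : T -> R) : measurable_fun [set: T] f ->
  `|\int[Pi]_x (f x)%:E| <= N f.
Proof.
move=> mf; apply: le_trans (Lnorm1_le2 mf).
by apply: le_abse_integral => //; exact/measurable_EFinP.
Qed.

Lemma Lfun2_integrable (f : T -> R) : f \in Lfun Pi 2%:E ->
  Pi.-integrable [set: T] (EFin \o f).
Proof.
move=> /Lfun2P[mf Nf]; apply/integrableP; split; first exact/measurable_EFinP.
exact: le_lt_trans (Lnorm1_le2 mf) Nf.
Qed.

Lemma Lfun2B (f g : T -> R) : f \in Lfun Pi 2%:E -> g \in Lfun Pi 2%:E ->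
  (f \- g)%R \in Lfun Pi 2%:E.
Proof.
move=> /Lfun2P[mf Nf] /Lfun2P[mg Ng]; apply/Lfun2P; split.
  exact: measurable_funB.
by apply: le_lt_trans (Lnorm2B Pi mf mg) _; rewrite lte_add_pinfty.
Qed.

End L2norm_probability.

(** * The Markov operator on L2 *)

Section markov_operator_L2.
Context d (T : measurableType d) (R : realType).
Variables (P : R.-pker T ~> T) (Pi : probability T R).
Local Notation N f := ('N[Pi]_2%:E[EFin \o f]).

(** The real-valued version of [markov_op]; for f in L2(Pi) the two agree
    Pi-almost everywhere, see [ae_markov_op]. *)
Definition mop (f : T -> R) (x : T) : R := fine (markov_op P f x).

Lemma measurable_markov_op f : measurable_fun [set: T] f ->
  measurable_fun [set: T] (markov_op P f).
Proof.
move=> mf; rewrite /markov_op.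
have mEf : measurable_fun [set: T] (EFin \o f) by exact/measurable_EFinP.
rewrite (_ : (fun _ => _) = (fun x => \int[P x]_y ((EFin \o f)^\+ y)) \-
    (fun x => \int[P x]_y ((EFin \o f)^\- y))); last first.
  by apply/funext => x; rewrite /= integralE.
apply: emeasurable_funB; apply: measurable_integral_kernel => //.
- exact: measurable_funepos.
- exact: measurable_funeneg.
Qed.

Lemma measurable_mop f : measurable_fun [set: T] f ->
  measurable_fun [set: T] (mop f).
Proof. by move=> mf; apply: measurableT_comp => //; exact: measurable_markov_op. Qed.

Lemma mop_ge0 f x : (forall y, 0 <= f y)%R -> (0 <= mop f x)%R.
Proof. by move=> f0; apply: fine_ge0; apply: integral_ge0 => y _; rewrite lee_fin. Qed.

Lemma integrable_markov_op f x : (P x).-integrable [set: T] (EFin \o f) ->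
  markov_op P f x = (mop f x)%:E.
Proof. by move=> Pf; rewrite fineK//; exact: integrable_fin_num. Qed.

Lemma mopB f g x : (P x).-integrable [set: T] (EFin \o f) ->
  (P x).-integrable [set: T] (EFin \o g) -> mop (f \- g)%R x = (mop f x - mop g x)%R.
Proof. by move=> Pf Pg; rewrite /mop /markov_op -RintegralB. Qed.

Lemma mopD f g x : (P x).-integrable [set: T] (EFin \o f) ->
  (P x).-integrable [set: T] (EFin \o g) -> mop (f \+ g)%R x = (mop f x + mop g x)%R.
Proof. by move=> Pf Pg; rewrite /mop /markov_op -RintegralD. Qed.

Lemma mop_cst c x : mop (cst c) x = c.
Proof. by rewrite /mop /markov_op /= integral_cst//= prob_kernel mule1. Qed.

Hypothesis revP : reversible P Pi.

(** By invariance the integral of P|f| is that of |f|, so P|f| is finite almost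
    everywhere. *)
Lemma ae_integrable_kernel f : Pi.-integrable [set: T] (EFin \o f) ->
  {ae Pi, forall x, (P x).-integrable [set: T] (EFin \o f)}.
Proof.
move=> /integrableP[mEf intf].
have mPf : measurable_fun [set: T] (fun x => \int[P x]_y `|(f y)%:E|).
  by apply: measurable_integral_kernel => //; exact: measurableT_comp.
have : Pi.-integrable [set: T] (fun x => \int[P x]_y `|(f y)%:E|).
  apply/integrableP; split => //.
  under eq_integral do rewrite gee0_abs ?integral_ge0//.
  by rewrite reversible_invariant//; exact: measurableT_comp.
move=> /(integrable_ae measurableT); apply: filterS => x /(_ I) Pfx.
apply/integrableP; split => //.
by rewrite -ge0_fin_numE// integral_ge0.
Qed.

(** Jensen's inequality |P f|^2 <= P (|f|^2), integrated against the invariant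
    measure. *)
Lemma Lnorm2_markov_op f : measurable_fun [set: T] f ->
  'N[Pi]_2%:E[markov_op P f] <= N f.
Proof.
move=> mf; have mPf := measurable_markov_op mf.
have mpow : measurable_fun [set: T] (fun y => `|(f y)%:E| `^ 2).
  apply: (measurableT_comp (measurable_poweR _)); apply: measurableT_comp => //.
  exact/measurable_EFinP.
rewrite unlock -[X in _ <= X `^ _](reversible_invariant revP)//; last first.
  by move=> x; exact: poweR_ge0.
apply: gt0_ler_poweR; first by [].
- rewrite in_itv/= leey andbT.
  by apply: integral_ge0 => x _; exact: poweR_ge0.
- rewrite in_itv/= leey andbT; apply: integral_ge0 => x _.
  by apply: integral_ge0 => y _; rewrite lee_fin powR_ge0.
apply: ge0_le_integral => //.
- by move=> x _; exact: poweR_ge0.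
- by apply: (measurableT_comp (measurable_poweR _)); exact: measurableT_comp.
- by apply: measurable_integral_kernel => // y; exact: poweR_ge0.
- move=> x _; rewrite -(sqr_Lnorm2 (P x) (EFin \o f)).
  rewrite gt0_ler_poweR// ?in_itv/= ?leey ?andbT ?Lnorm_ge0//.
  exact: (@abse_integral_le_Lnorm2 _ _ _ (P x) (prob_kernel x) f mf).
Qed.

Lemma ae_markov_op f : f \in Lfun Pi 2%:E ->
  ae_eq Pi [set: T] (markov_op P f) (EFin \o mop f).
Proof.
move=> f2; have := ae_integrable_kernel (Lfun2_integrable (probability_setT Pi) f2).
by apply: filterS => x Pfx _; rewrite integrable_markov_op.
Qed.

Lemma Lnorm2_mop f : f \in Lfun Pi 2%:E -> N (mop f) <= N f.
Proof.
move=> f2; have /Lfun2P[mf _] := f2.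
rewrite -(@ae_eq_Lnorm2 _ _ _ Pi (markov_op P f)).
- exact: Lnorm2_markov_op.
- exact: measurable_markov_op.
- by apply/measurable_EFinP; exact: measurable_mop.
- exact: ae_markov_op.
Qed.

Lemma Lfun2_mop f : f \in Lfun Pi 2%:E -> mop f \in Lfun Pi 2%:E.
Proof.
move=> f2; have /Lfun2P[mf Nf] := f2; apply/Lfun2P; split.
  exact: measurable_mop.
exact: le_lt_trans (Lnorm2_mop f2) Nf.
Qed.

Definition mean f : R := \int[Pi]_x f x.

Definition centered f : T -> R := (f \- cst (mean f))%R.

Lemma measurable_centered f : measurable_fun [set: T] f ->
  measurable_fun [set: T] (centered f).
Proof. by move=> mf; exact: measurable_funB. Qed.

Lemma Lfun2_centered f : f \in Lfun Pi 2%:E -> centered f \in Lfun Pi 2%:E.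
Proof. by move=> f2; apply: Lfun2B => //; exact: Lfun_cst. Qed.

Lemma ae_mopB f g : f \in Lfun Pi 2%:E -> g \in Lfun Pi 2%:E ->
  {ae Pi, forall x, mop (f \- g)%R x = (mop f x - mop g x)%R}.
Proof.
move=> f2 g2.
have := ae_integrable_kernel (Lfun2_integrable (probability_setT Pi) f2).
have := ae_integrable_kernel (Lfun2_integrable (probability_setT Pi) g2).
by apply: filterS2 => x Pg Pf; exact: mopB.
Qed.

Lemma Lnorm2_mop_center f : f \in Lfun Pi 2%:E ->
  N (mop f \- cst (mean f))%R = N (mop (centered f)).
Proof.
move=> f2; have /Lfun2P[mf _] := f2.
apply: ae_eq_Lnorm2.
- by apply/measurable_EFinP; apply: measurable_funB => //; exact: measurable_mop.
- by apply/measurable_EFinP; apply: measurable_mop; exact: measurable_centered.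
- apply: filterS (ae_mopB f2 (Lfun_cst Pi (mean f) 2)) => x /= -> _.
  by rewrite mop_cst.
Qed.

(** The supremum ranges over functions of nonzero deviation only; for the
    others the inequality follows from the contraction [Lnorm2_mop]. *)
Lemma spectral_betaP (rho : R) : (0 <= rho)%R ->
  spectral_beta P Pi <= rho%:E <->
  forall f, f \in Lfun Pi 2%:E ->
    N (mop f \- cst (mean f))%R <= rho%:E * N (centered f).
Proof.
move=> rho0.
have meanE f : f \in Lfun Pi 2%:E -> \int[Pi]_x (f x)%:E = (mean f)%:E.
  move=> f2; rewrite /mean fineK//; apply: (integrable_fin_num measurableT).
  exact: (Lfun2_integrable (probability_setT Pi) f2).
have devE f : f \in Lfun Pi 2%:E ->
    'N[Pi]_2%:E[(fun x => (f x)%:E - \int[Pi]_x (f x)%:E)] = N (centered f).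
  by move=> f2; rewrite meanE//; apply: eq_Lnorm => x.
have opdevE f : f \in Lfun Pi 2%:E ->
    'N[Pi]_2%:E[(fun x => markov_op P f x - \int[Pi]_x (f x)%:E)] =
    N (mop f \- cst (mean f))%R.
  move=> f2; have /Lfun2P[mf _] := f2; rewrite meanE//; apply: ae_eq_Lnorm2.
  - apply: emeasurable_funB; first exact: measurable_markov_op.
    exact: measurable_cst.
  - by apply/measurable_EFinP; apply: measurable_funB => //; exact: measurable_mop.
  - by apply: filterS (ae_markov_op f2) => x /(_ I) ->.
have divE f : f \in Lfun Pi 2%:E -> N (centered f) != 0 ->
    (N (mop f \- cst (mean f))%R / N (centered f) <= rho%:E) =
    (N (mop f \- cst (mean f))%R <= rho%:E * N (centered f)).
  move=> f2 N0; have /Lfun2P[_ Ny] := Lfun2_centered f2.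
  have Nfin : N (centered f) \is a fin_num by rewrite ge0_fin_numE ?Lnorm_ge0.
  have Npos : (0 < fine (N (centered f)))%R by rewrite fine_gt0// Ny lt0e N0 Lnorm_ge0.
  by rewrite -{1 2}(fineK Nfin) inver gt_eqF// lee_pdivrMr// fineK.
split => [beta f f2|gap].
  have [N0|N0] := eqVneq (N (centered f)) 0.
    rewrite N0 mule0 Lnorm2_mop_center// -N0.
    by apply: Lnorm2_mop; exact: Lfun2_centered.
  rewrite -divE//; apply: le_trans beta; apply: ereal_sup_ubound.
  by exists f; rewrite ?devE ?opdevE//; split => //; rewrite devE.
apply: ge_ereal_sup => _ [f /= [f2 dev0] <-].
by rewrite opdevE// devE// divE//; [exact: gap|rewrite -devE].
Qed.

End markov_operator_L2.

(** * Evolution of densities *)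

Section evolution.
Context d (T : measurableType d) (R : realType).
Variables (P : R.-pker T ~> T) (Pi : probability T R).
Local Notation N f := ('N[Pi]_2%:E[EFin \o f]).

Lemma integral_kact (mu : probability T R) (Q : R.-pker T ~> T) f :
  (forall x, 0 <= f x) -> measurable_fun [set: T] f ->
  \int[kact mu Q]_y f y = \int[mu]_x \int[Q x]_y f y.
Proof.
move=> f0 mf.
have i0 (x : T) : (0 <= (cst 1 : T -> R) x)%R by [].
have mi : measurable_fun [set: T] (cst 1%R : T -> R) by [].
transitivity (\int[mixture mu Q i0 mi]_y f y).
  apply: eq_measure_integral => A mA _.
  by apply: eq_integral => x _; rewrite mul1e.
by rewrite integral_mixture//; apply: eq_integral => x _; rewrite mul1e.
Qed.

Lemma kact_kiterS (mu : probability T R) t A : measurable A ->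
  kact mu (kiter P t.+1) A = \int[kact mu (kiter P t)]_y P y A.
Proof.
move=> mA; rewrite integral_kact//; exact: measurable_kernel.
Qed.

Lemma integral_has_density (nu : {measure set T -> \bar R}) (h : T -> R) f :
  (forall x, 0 <= h x)%R -> measurable_fun [set: T] h ->
  (forall A, measurable A -> nu A = \int[Pi]_(x in A) (h x)%:E) ->
  (forall x, 0 <= f x) -> measurable_fun [set: T] f ->
  \int[nu]_x f x = \int[Pi]_x ((h x)%:E * f x).
Proof.
move=> h0 mh nuE f0 mf; rewrite -(@integral_density _ _ _ Pi h h0 mh)//.
by apply: eq_measure_integral => A mA _; rewrite nuE// -densityE.
Qed.

Hypothesis revP : reversible P Pi.

(** Here reversibility enters: P acts on densities as it acts on functions. *)
Lemma density_kernel_step (nu : {measure set T -> \bar R}) (h : T -> R) :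
  (forall x, 0 <= h x)%R -> h \in Lfun Pi 2%:E ->
  (forall A, measurable A -> nu A = \int[Pi]_(x in A) (h x)%:E) ->
  forall A, measurable A ->
    \int[nu]_y P y A = \int[Pi]_(x in A) (mop P h x)%:E.
Proof.
move=> h0 h2 nuE A mA; have /Lfun2P[mh _] := h2.
have mEh : measurable_fun [set: T] (EFin \o h) by exact/measurable_EFinP.
rewrite (integral_has_density h0 mh nuE)//; last exact: measurable_kernel.
transitivity (\int[Pi]_x ((\1_A x)%:E * markov_op P h x)).
  rewrite (reversible_integral revP (M := 1%R))//.
  - by apply: eq_integral => x _; rewrite integral_indic// setIT.
  - by move=> x; rewrite indicE; case: (_ \in _); rewrite ?lexx ?ler01.
rewrite [RHS]integral_mkcond; apply: ae_eq_integral => //.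
- apply: emeasurable_funM; last exact: measurable_markov_op.
  exact/measurable_EFinP.
- apply/(measurable_restrictT _ _).1 => //; apply/measurable_EFinP.
  by apply: measurable_funTS; exact: measurable_mop.
apply: filterS (ae_markov_op revP h2) => x /(_ I) -> _.
by rewrite epatch_indic muleC.
Qed.

Lemma iter_mop_ge0 h t x : (forall y, 0 <= h y)%R -> (0 <= iter t (mop P) h x)%R.
Proof.
by move=> h0; elim: t x => //= t IH x; exact: mop_ge0.
Qed.

Lemma Lfun2_iter_mop h t : h \in Lfun Pi 2%:E -> iter t (mop P) h \in Lfun Pi 2%:E.
Proof. by move=> h2; elim: t => //= t IH; exact: Lfun2_mop. Qed.

Lemma kact_kiter_density (mu : probability T R) (h : T -> R) t :
  (forall x, 0 <= h x)%R -> h \in Lfun Pi 2%:E ->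
  (forall A, measurable A -> mu A = \int[Pi]_(x in A) (h x)%:E) ->
  forall A, measurable A ->
    kact mu (kiter P t) A = \int[Pi]_(x in A) (iter t (mop P) h x)%:E.
Proof.
move=> h0 h2 muE; elim: t => [|t IH] A mA.
  transitivity (\int[mu]_x (\1_A x)%:E); last by rewrite integral_indic// setIT; exact: muE.
  exact: eq_integral.
rewrite kact_kiterS//; apply: density_kernel_step => //.
- by move=> x; exact: iter_mop_ge0.
- exact: Lfun2_iter_mop.
Qed.

(** The deviation of P^(t+1) h from its mean is what the gap inequality bounds
    for P^t h, because all these functions have the same mean 1. *)
Lemma gap_iter (rho : R) h t : (0 <= rho)%R ->
  (forall f, f \in Lfun Pi 2%:E ->
    N (mop P f \- cst (mean Pi f))%R <= rho%:E * N (centered Pi f)) ->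
  h \in Lfun Pi 2%:E -> (forall s, mean Pi (iter s (mop P) h) = 1%R) ->
  N (centered Pi (iter t (mop P) h)) <= (rho ^+ t)%:E * N (centered Pi h).
Proof.
move=> rho0 gap h2 mean1; elim: t => [|t IH]; first by rewrite expr0 mul1e.
have -> : centered Pi (iter t.+1 (mop P) h) =
    (mop P (iter t (mop P) h) \- cst (mean Pi (iter t (mop P) h)))%R.
  by rewrite /centered !mean1.
apply: le_trans (gap _ (Lfun2_iter_mop t h2)) _.
rewrite exprS EFinM -muleA; apply: lee_wpmul2l => //.
Qed.

End evolution.

(** * Borel sections of the square of a metric space *)

Section borel_maps.
Context (R : realType) (T : pointedMetricType R).

Lemma generated_measurable (S U : pointedType) (GS : set (set S))
    (GU : set (set U)) (f : S -> U) : (forall B, GU B -> GS (f @^-1` B)) ->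
  measurable_fun [set: g_sigma_algebraType GS]
    (f : g_sigma_algebraType GS -> g_sigma_algebraType GU).
Proof.
move=> fG.
apply: (@measurability _ _ (g_sigma_algebraType GS) (g_sigma_algebraType GU)
  setT f GU) => //.
by move=> _ [B GB <-]; rewrite setTI; apply: sub_sigma_algebra; exact: fG.
Qed.

Lemma open_borel (A : set T) : open A -> measurable (A : set (borel T)).
Proof. by move=> oA; exact: sub_sigma_algebra. Qed.

Lemma lower_semicontinuous_borel_measurable (f : T -> \bar R) :
  lower_semicontinuous f -> measurable_fun [set: borel T] (f : borel T -> \bar R).
Proof.
move=> scif; apply: (measurability _ (ErealGenOInfty.measurableE R)).
move=> /= _ [_ [a ->]] <-; rewrite setTI; apply: open_borel.
by rewrite preimage_itvoy; move/lower_semicontinuousP : scif; exact.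
Qed.

Lemma measurable_pair_borel (x : T) :
  measurable_fun [set: borel T] (pair x : borel T -> borel (T * T)%type).
Proof.
have c : continuous (pair x : T -> (T * T)%type).
  by move=> y; apply: cvg_pair; [exact: cvg_cst|exact: cvg_id].
by apply: generated_measurable; apply/continuousP.
Qed.

Lemma measurable_diag_borel :
  measurable_fun [set: borel T] ((fun x => (x, x)) : borel T -> borel (T * T)%type).
Proof.
have c : continuous (fun x : T => (x, x)) by move=> y; apply: cvg_pair; exact: cvg_id.
by apply: generated_measurable; apply/continuousP.
Qed.

Lemma measurable_fst_borel :
  measurable_fun [set: borel (T * T)%type] (fst : borel (T * T)%type -> borel T).
Proof.
have c : continuous (fst : (T * T)%type -> T) by move=> z; exact: cvg_fst.
by apply: generated_measurable; apply/continuousP.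
Qed.

Lemma measurable_snd_borel :
  measurable_fun [set: borel (T * T)%type] (snd : borel (T * T)%type -> borel T).
Proof.
have c : continuous (snd : (T * T)%type -> T) by move=> z; exact: cvg_snd.
by apply: generated_measurable; apply/continuousP.
Qed.

(** If (x, y) is in the open set A, then A contains the product of a ball of
    radius 1/(n+1) around x with a neighborhood of y.  The open sets O n of such
    y exhaust the section at x, and each O n lies in the section at every point
    close to x. *)
Lemma lower_semicontinuous_section (nu : {measure set (borel T) -> \bar R})
  (A : set (T * T)) : open A -> lower_semicontinuous (fun x : T => nu (pair x @^-1` A)).
Proof.
move=> oA x a.
pose O n : set T :=
  interior [set y | forall z, ball x n.+1%:R^-1 z -> A (z, y)].
have oO n : open (O n) by exact: open_interior.
have OA : \bigcup_n O n = pair x @^-1` A.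
  apply/seteqP; split => [y [n _ /nbhs_singleton /=]|y /= Axy].
    by apply; exact: ballxx.
  have [[U V]/= [Ux Vy] UVA] : nbhs (x, y) A by apply: open_nbhs_nbhs.
  move/nbhs_ballP : Ux => [e /= e0 eU].
  have [n ne] : exists n, (n.+1%:R^-1 < e)%R.
    by exists (Num.truncn e^-1); rewrite invf_plt ?posrE//; exact: truncnS_gt.
  exists n => //; apply: filterS Vy => v Vv z xz; apply: UVA; split => //=.
  by apply: eU; apply: le_ball xz; exact: ltW.
have ndO : nondecreasing_seq O.
  move=> m n mn; apply/subsetPset => y; apply: filterS => z mz u xu; apply: mz.
  by apply: le_ball xu; rewrite lef_pV2 ?posrE// ler_nat.
have mO n : measurable (O n : set (borel T)) by exact: open_borel.
have mOA : measurable (\bigcup_n O n : set (borel T)) by exact: bigcup_measurable.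
have /= := nondecreasing_cvg_mu (mu := nu) mO mOA ndO.
rewrite OA => nuO anuA.
have [n an] : exists n, a%:E < nu (O n).
  apply: contrapT => /forallNP /= h; move: anuA; rewrite ltNge => /negP; apply.
  rewrite -(cvg_lim _ nuO)//; apply: lime_le; first by apply/cvg_ex; eexists; exact: nuO.
  by apply: nearW => n /=; rewrite leNgt; apply/negP; exact: h.
exists (ball x n.+1%:R^-1); first exact: nbhsx_ballx.
move=> z xz; apply: lt_le_trans an _; apply: le_measure; rewrite ?inE//.
  rewrite -[X in measurable X]setTI; apply: (measurable_pair_borel z) => //.
  exact: sub_sigma_algebra.
by move=> y /nbhs_singleton; exact.
Qed.

(** Lower semicontinuity settles the open sets, which are stable under
    intersection and generate; finiteness of nu is what makes the class stable
    under complement. *)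
Lemma measurable_section (nu : {measure set (borel T) -> \bar R})
    (A : set (borel (T * T)%type)) : nu setT < +oo -> measurable A ->
  measurable_fun [set: borel T] (fun x : borel T => nu (pair x @^-1` A)).
Proof.
move=> nufin mA.
have mpre (B : set (borel (T * T)%type)) x : measurable B ->
    measurable (pair x @^-1` B : set (borel T)).
  by move=> mB; rewrite -[X in measurable X]setTI; exact: measurable_pair_borel.
apply: (@dynkin_induction _ (borel (T * T)%type) (@open (T * T)%type)
  [set A | measurable_fun [set: borel T] (fun x : borel T => nu (pair x @^-1` A))]) => //=.
- by move=> B C; exact: openI.
- under eq_fun do rewrite preimage_setT.
  exact: measurable_cst.
- move=> B oB; apply: lower_semicontinuous_borel_measurable.
  exact: lower_semicontinuous_section.
- move=> B mB mnuB.
  rewrite (_ : (fun _ => _) =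
      cst (nu setT) \- (fun x : borel T => nu (pair x @^-1` B))).
    by apply: emeasurable_funB.
  apply/funext => x /=; rewrite preimage_setC -setTD (measureD measurableT (mpre _ _ mB)).
    by rewrite setTI.
  exact: nufin.
- move=> F mF tF mnuF.
  rewrite (_ : (fun _ => _) =
      (fun x : borel T => \sum_(n <oo) nu (pair x @^-1` F n))).
    by apply: ge0_emeasurable_sum => // n x _ _; exact: measure_ge0.
  apply/funext => x; rewrite preimage_bigcup measure_semi_bigcup//.
  - by move=> n; exact: mpre.
  - apply/trivIsetP => i j _ _ ij; rewrite -preimage_setI.
    by move/trivIsetP : tF => /(_ _ _ _ _ ij) ->//; rewrite preimage_set0.
  - by apply: bigcup_measurable => n _; exact: mpre.
Qed.

End borel_maps.

(** * The truncated distance and product kernels *)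

Section cost.
Context (R : realType) (T : pointedMetricType R).

Lemma measurable_mdist : measurable_fun [set: borel (T * T)%type]
  ((fun z => mdist z.1 z.2) : borel (T * T)%type -> R).
Proof.
apply: (measurability _ (RGenInftyO.measurableE R)) => _ [_ [a ->] <-].
rewrite setTI; apply: sub_sigma_algebra.
rewrite openE => -[x y] /=; rewrite in_itv/= => xya.
set e := ((a - mdist x y) / 2)%R.
have e0 : (0 < e)%R by rewrite divr_gt0// subr_gt0.
exists (ball x e, ball y e); first by split; exact: nbhsx_ballx.
move=> [x' y'] [/=]; rewrite !ballEmdist/= => xx' yy'; rewrite in_itv/=.
have h1 := metric_triangle x' x y'; have h2 := metric_triangle x y y'.
by move: xx' yy'; rewrite /e (metric_sym x x'); lra.
Qed.

Definition cost (z : T * T) : R := Num.min (mdist z.1 z.2) 1%R.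

Lemma measurable_cost : measurable_fun [set: borel (T * T)%type]
  (cost : borel (T * T)%type -> R).
Proof. by apply: measurable_minr => //; exact: measurable_mdist. Qed.

Lemma cost_ge0 z : (0 <= cost z)%R.
Proof. by rewrite le_min mdist_ge0 ler01. Qed.

Lemma cost_le1 z : (cost z <= 1)%R.
Proof. by rewrite ge_min lexx orbT. Qed.

Lemma cost_diag x : cost (x, x) = 0%R.
Proof. by rewrite /cost /= mdistxx min_l. Qed.

End cost.

Section product_kernel.
Context (R : realType) (T : pointedMetricType R).
Variables (m : {measure set (borel T) -> \bar R}) (v : borel T -> R).
Hypotheses (v0 : forall x, (0 <= v x)%R) (mv : measurable_fun [set: borel T] v).

Definition product_kernel (x : borel T) :=
  mixture m (kdirac (measurable_pair_borel x)) v0 mv.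

HB.instance Definition _ x := Measure.on (product_kernel x).

Hypothesis vfin : \int[m]_y (v y)%:E < +oo.

(** For fixed x, the image of the measure of density v under y |-> (x, y).  The
    finiteness of that measure is recorded in the signature because the
    measurability in x, hence the kernel structure, relies on it. *)
Definition finite_product_kernel of \int[m]_y (v y)%:E < +oo :
  borel T -> {measure set (borel (T * T)%type) -> \bar R} := product_kernel.

Lemma product_kernelE x (A : set (borel (T * T)%type)) : measurable A ->
  product_kernel x A = \int[m]_(y in pair x @^-1` A) (v y)%:E.
Proof.
move=> mA; rewrite integral_mkcond; apply: eq_integral => y _.
by rewrite epatch_indic.
Qed.

Let measurable_product_kernel A : measurable A ->
  measurable_fun [set: borel T] (finite_product_kernel vfin ^~ A).
Proof.
move=> mA.
have -> : finite_product_kernel vfin ^~ A = fun x => density m v0 mv (pair x @^-1` A).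
  apply/funext => x; rewrite densityE; first exact: product_kernelE.
  by rewrite -[X in measurable X]setTI; exact: measurable_pair_borel.
by apply: measurable_section => //; rewrite /= densityE.
Qed.

HB.instance Definition _ := isKernel.Build _ _ _ _ _
  (finite_product_kernel vfin) measurable_product_kernel.

End product_kernel.

(** * The maximal coupling *)

Section maximal_coupling.
Context (R : realType) (T : pointedMetricType R).
Variables (Pi : probability (borel T) R) (h : borel T -> R).
Hypotheses (h0 : forall x, (0 <= h x)%R) (mh : measurable_fun [set: borel T] h).

(** With h the density of a law with respect to Pi, the mass min(h, 1) common to
    both laws stays on the diagonal, while the excess (h - 1)^+ of the first law
    is moved to the deficit (1 - h)^+. *)
Let shared x : R := Num.min (h x) 1%R.
Let excess x : R := Num.max (h x - 1)%R 0%R.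
Let deficit x : R := Num.max (1 - h x)%R 0%R.

Let shared_ge0 x : (0 <= shared x)%R.
Proof. by rewrite /shared le_min h0 ler01. Qed.

Let excess_ge0 x : (0 <= excess x)%R.
Proof. by rewrite /excess le_max lexx orbT. Qed.

Let deficit_ge0 x : (0 <= deficit x)%R.
Proof. by rewrite /deficit le_max lexx orbT. Qed.

Let measurable_shared : measurable_fun [set: borel T] shared.
Proof. exact: measurable_minr. Qed.

Let measurable_excess : measurable_fun [set: borel T] excess.
Proof. by apply: measurable_maxr => //; exact: measurable_funB. Qed.

Let measurable_deficit : measurable_fun [set: borel T] deficit.
Proof. by apply: measurable_maxr => //; exact: measurable_funB. Qed.

Let shared_excess x : h x = (shared x + excess x)%R.
Proof.
rewrite /shared /excess; have [h1|h1] := leP (h x) 1%R.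
  by rewrite max_r ?addr0// subr_le0.
by rewrite max_l ?subrKC// subr_ge0 ltW.
Qed.

Let shared_deficit x : 1%R = (shared x + deficit x)%R.
Proof.
rewrite /shared /deficit; have [h1|h1] := leP (h x) 1%R.
  by rewrite max_l ?subrKC// subr_ge0.
by rewrite max_r ?addr0// subr_le0 ltW.
Qed.

Let mE (f : borel T -> R) (A : set (borel T)) : measurable_fun [set: borel T] f ->
  measurable_fun A (EFin \o f).
Proof. by move=> mf; apply: measurable_funTS; exact/measurable_EFinP. Qed.

Let integral_shared_excess (A : set (borel T)) : measurable A ->
  \int[Pi]_(x in A) (h x)%:E =
  \int[Pi]_(x in A) (shared x)%:E + \int[Pi]_(x in A) (excess x)%:E.
Proof.
move=> mA; rewrite -ge0_integralD//; try exact: mE;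
  try by move=> x _; rewrite lee_fin.
by apply: eq_integral => x _; rewrite -EFinD -shared_excess.
Qed.

Let integral_shared_deficit (A : set (borel T)) : measurable A ->
  Pi A = \int[Pi]_(x in A) (shared x)%:E + \int[Pi]_(x in A) (deficit x)%:E.
Proof.
move=> mA; rewrite -ge0_integralD//; try exact: mE;
  try by move=> x _; rewrite lee_fin.
rewrite -[LHS]mul1e -integral_cst//.
by apply: eq_integral => x _; rewrite -EFinD -shared_deficit.
Qed.

Hypothesis h1 : \int[Pi]_x (h x)%:E = 1.

Let shared_fin : \int[Pi]_x (shared x)%:E \is a fin_num.
Proof.
rewrite ge0_fin_numE; last by apply: integral_ge0 => x _; rewrite lee_fin.
rewrite (@le_lt_trans _ _ 1) ?ltry// -h1 integral_shared_excess// leeDl//.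
by apply: integral_ge0 => x _; rewrite lee_fin.
Qed.

Let excess_deficit : \int[Pi]_x (excess x)%:E = \int[Pi]_x (deficit x)%:E.
Proof.
rewrite -[LHS](addeK _ shared_fin) -[RHS](addeK _ shared_fin); congr (_ - _).
rewrite addeC [RHS]addeC -integral_shared_excess// -integral_shared_deficit//.
by rewrite h1 probability_setT.
Qed.

Let excess_fin : \int[Pi]_x (excess x)%:E \is a fin_num.
Proof.
have int0 : 0 <= \int[Pi]_x (excess x)%:E.
  by apply: integral_ge0 => x _; rewrite lee_fin.
rewrite ge0_fin_numE// (@le_lt_trans _ _ 1) ?ltry// -h1.
rewrite integral_shared_excess// leeDr//.
by apply: integral_ge0 => x _; rewrite lee_fin.
Qed.

(** The common mass of the excess and of the deficit: the total variation
    distance between the two laws. *)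
Let delta : R := (\int[Pi]_x excess x)%R.

Let deltaE : \int[Pi]_x (excess x)%:E = delta%:E.
Proof. by rewrite fineK. Qed.

Let delta_ge0 : (0 <= delta)%R.
Proof. by apply: fine_ge0; apply: integral_ge0 => x _; rewrite lee_fin. Qed.

Let deficit_lty : \int[Pi]_x (deficit x)%:E < +oo.
Proof. by rewrite -excess_deficit deltaE ltry. Qed.

Let normalized x : R := (delta^-1 * excess x)%R.

Let normalized_ge0 x : (0 <= normalized x)%R.
Proof. by rewrite mulr_ge0// invr_ge0. Qed.

Let measurable_normalized : measurable_fun [set: borel T] normalized.
Proof. exact: measurable_funM. Qed.

Let diagonal_part := mixture Pi (kdirac (@measurable_diag_borel R T))
  shared_ge0 measurable_shared.

Let jump_part := mixture Pi
  (finite_product_kernel deficit_ge0 measurable_deficit deficit_lty)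
  normalized_ge0 measurable_normalized.

(** When delta vanishes its inverse is 0 as well, but then there is no excess
    to transport. *)
Let delta_excess (A : set (borel T)) : measurable A ->
  (delta^-1 * delta)%:E * \int[Pi]_(x in A) (excess x)%:E =
  \int[Pi]_(x in A) (excess x)%:E.
Proof.
move=> mA; have [d0|d0] := eqVneq delta 0%R; last by rewrite mulVf// mul1e.
suff -> : \int[Pi]_(x in A) (excess x)%:E = 0 by rewrite mule0.
apply/eqP; rewrite eq_le; apply/andP; split; last first.
  by apply: integral_ge0 => x _; rewrite lee_fin.
rewrite -[leRHS]/(0%:E) -d0 -deltaE; apply: ge0_subset_integral => //.
- exact: mE.
- by move=> x _; rewrite lee_fin.
Qed.

Let integral_jump_part f : (forall z, 0 <= f z) ->
  measurable_fun [set: borel (T * T)%type] f ->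
  \int[jump_part]_z f z = \int[Pi]_x ((normalized x)%:E *
     \int[Pi]_y ((deficit y)%:E * f (x, y))).
Proof.
move=> f0 mf; rewrite integral_mixture//; apply: eq_integral => x _.
rewrite integral_mixture//; congr (_ * _); apply: eq_integral => y _.
by rewrite /= integral_dirac// diracT mul1e.
Qed.

Let integral_diagonal_part f : (forall z, 0 <= f z) ->
  measurable_fun [set: borel (T * T)%type] f ->
  \int[diagonal_part]_z f z = \int[Pi]_x ((shared x)%:E * f (x, x)).
Proof.
move=> f0 mf; rewrite integral_mixture//; apply: eq_integral => x _.
by rewrite /= integral_dirac// diracT mul1e.
Qed.

Definition maximal_coupling := measure_add diagonal_part jump_part.

HB.instance Definition _ := Measure.on maximal_coupling.

Let maximal_couplingE (D : set (borel (T * T)%type)) :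
  maximal_coupling D = \int[Pi]_x ((shared x)%:E * (\1_D (x, x))%:E) +
    \int[Pi]_x ((normalized x)%:E *
      \int[Pi]_y ((deficit y)%:E * (\1_D (x, y))%:E)).
Proof. exact: measure_addE. Qed.

Let integral_weighted_indic (w : borel T -> R) (B : set (borel T)) :
  \int[Pi]_x ((w x)%:E * (\1_B x)%:E) = \int[Pi]_(x in B) (w x)%:E.
Proof.
by rewrite [RHS]integral_mkcond; apply: eq_integral => x _; rewrite epatch_indic.
Qed.

Let integral_normalized (B : set (borel T)) : measurable B ->
  \int[Pi]_x ((normalized x)%:E * (\1_B x)%:E) * delta%:E =
  \int[Pi]_(x in B) (excess x)%:E.
Proof.
move=> mB; rewrite integral_weighted_indic.
under eq_integral do rewrite EFinM.
rewrite ge0_integralZl//.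
- by rewrite muleAC -EFinM delta_excess.
- exact: mE.
- by move=> x _; rewrite lee_fin.
- by rewrite lee_fin invr_ge0.
Qed.

Lemma maximal_coupling_fst (B : set (borel T)) : measurable B ->
  maximal_coupling (fst @^-1` B) = \int[Pi]_(x in B) (h x)%:E.
Proof.
move=> mB; rewrite maximal_couplingE integral_shared_excess//; congr (_ + _).
  rewrite -integral_weighted_indic; apply: eq_integral => x _.
  by [].
rewrite -integral_normalized// -ge0_integralZr//; last 2 first.
- by apply: emeasurable_funM; apply/measurable_EFinP.
- by move=> x _; rewrite mule_ge0// lee_fin.
apply: eq_integral => x _; rewrite -muleA; congr (_ * _).
rewrite -deltaE excess_deficit -ge0_integralZl//; last 2 first.
- exact: mE.
- by move=> y _; rewrite lee_fin.
by apply: eq_integral => y _; rewrite muleC.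
Qed.

Lemma maximal_coupling_snd (B : set (borel T)) : measurable B ->
  maximal_coupling (snd @^-1` B) = Pi B.
Proof.
move=> mB; rewrite maximal_couplingE integral_shared_deficit//; congr (_ + _).
  rewrite -integral_weighted_indic; apply: eq_integral => x _.
  by [].
transitivity (\int[Pi]_x ((normalized x)%:E * \int[Pi]_(y in B) (deficit y)%:E)).
  apply: eq_integral => x _; congr (_ * _); rewrite -integral_weighted_indic.
  by apply: eq_integral => y _.
have dB0 : 0 <= \int[Pi]_(y in B) (deficit y)%:E.
  by apply: integral_ge0 => x _; rewrite lee_fin.
rewrite ge0_integralZr//; last 2 first.
- exact: mE.
- by move=> x _; rewrite lee_fin.
under eq_integral do rewrite EFinM.
rewrite ge0_integralZl//; last 3 first.
- exact: mE.
- by move=> x _; rewrite lee_fin.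
- by rewrite lee_fin invr_ge0.
rewrite deltaE -EFinM.
have [d0|d0] := eqVneq delta 0%R; last by rewrite mulVf// mul1e.
suff -> : \int[Pi]_(x in B) (deficit x)%:E = 0 by rewrite mule0.
apply/eqP; rewrite eq_le dB0 andbT -[leRHS]/(0%:E) -d0 -deltaE excess_deficit.
apply: ge0_subset_integral => //; first exact: mE.
by move=> x _; rewrite lee_fin.
Qed.

Lemma maximal_coupling_setT : maximal_coupling [set: borel (T * T)%type] = 1.
Proof. by rewrite -(preimage_setT snd) maximal_coupling_snd// probability_setT. Qed.

HB.instance Definition _ := Measure_isProbability.Build _ _ _ maximal_coupling
  maximal_coupling_setT.

(** The diagonal part costs nothing and the rest has total mass delta. *)
Lemma integral_maximal_coupling (f : borel (T * T)%type -> R) :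
  (forall z, 0 <= f z <= 1)%R -> measurable_fun [set: borel (T * T)%type] f ->
  (forall x, f (x, x) = 0%R) ->
  \int[maximal_coupling]_z (f z)%:E <= \int[Pi]_x (Num.max (h x - 1) 0)%:E.
Proof.
move=> f01 mf fdiag.
have f0 z : 0 <= (f z)%:E by rewrite lee_fin; have /andP[] := f01 z.
have mEf : measurable_fun [set: borel (T * T)%type] (EFin \o f).
  exact/measurable_EFinP.
rewrite ge0_integral_measure_add//.
rewrite integral_diagonal_part//.
rewrite [X in X + _](_ : _ = 0) ?add0e; last first.
  by apply: integral0_eq => x _; rewrite fdiag mule0.
apply: (@le_trans _ _ (\int[jump_part]_z 1)).
  apply: ge0_le_integral => // z _.
  by rewrite lee_fin; have /andP[] := f01 z.
rewrite integral_jump_part//.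
rewrite -[leRHS](integral_normalized measurableT) -ge0_integralZr//; last 2 first.
- by apply: emeasurable_funM; apply/measurable_EFinP.
- by move=> x _; rewrite mule_ge0// lee_fin.
rewrite le_eqVlt; apply/orP; left; apply/eqP; apply: eq_integral => x _.
rewrite indicT mule1 -deltaE excess_deficit.
by congr (_ * _); apply: eq_integral => y _; rewrite mule1.
Qed.

End maximal_coupling.

(** * From the spectral gap to Wasserstein convergence *)

Section forward.
Context (R : realType) (T : pointedMetricType R).
Variables (Pi : probability (borel T) R).
Local Notation N f := ('N[Pi]_2%:E[EFin \o f]).

Lemma wasserstein_le_Lnorm2 (nu : probability (borel T) R) (h : borel T -> R) :
  (forall x, 0 <= h x)%R -> measurable_fun [set: borel T] h ->
  (forall A, measurable A -> nu A = \int[Pi]_(x in A) (h x)%:E) ->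
  wasserstein_min1 nu Pi <= N (h \- cst 1)%R.
Proof.
move=> h0 mh nuE.
have h1 : \int[Pi]_x (h x)%:E = 1 by rewrite -nuE// probability_setT.
have mh1 : measurable_fun [set: borel T] (h \- cst 1)%R by exact: measurable_funB.
apply: (@le_trans _ _ (\int[maximal_coupling h0 mh h1]_z (cost z)%:E)).
  apply: ereal_inf_lbound; exists (maximal_coupling h0 mh h1) => //.
  split => B mB; first by rewrite nuE//; exact: maximal_coupling_fst.
  exact: maximal_coupling_snd.
apply: le_trans (Lnorm1_le2 (probability_setT Pi) mh1).
apply: le_trans.
  apply: integral_maximal_coupling.
  - by move=> z; rewrite cost_ge0 cost_le1.
  - exact: measurable_cost.
  - exact: cost_diag.
apply: ge0_le_integral => //.
- by move=> x _; rewrite lee_fin le_max lexx orbT.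
- by apply/measurable_EFinP; apply: measurable_maxr.
- by apply: measurableT_comp => //; exact/measurable_EFinP.
- by move=> x _; rewrite lee_fin ge_max ler_norm normr_ge0.
Qed.

(** The derivative in [has_L2_density] is that of a charge, so it is nonnegative
    only almost everywhere; the derivative of a finite measure is nonnegative
    everywhere and agrees with it almost everywhere. *)
Lemma has_L2_densityP (mu : probability (borel T) R) : has_L2_density mu Pi ->
  exists h : borel T -> R, [/\ (forall x, 0 <= h x)%R, h \in Lfun Pi 2%:E &
    forall A, measurable A -> mu A = \int[Pi]_(x in A) (h x)%:E].
Proof.
move=> [muPi dmu2]; have /Lfun2P[mdmu Ndmu] := dmu2.
pose f := Radon_Nikodym_SigmaFinite.f mu Pi.
have fE x : (fine (f x))%:E = f x.
  by rewrite fineK//; exact: Radon_Nikodym_SigmaFinite.f_fin_num.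
have mf : measurable_fun [set: borel T] f.
  exact: measurable_int (Radon_Nikodym_SigmaFinite.f_integrable muPi).
have mff : measurable_fun [set: borel T] (fine \o f) by exact: measurableT_comp.
exists (fine \o f); split.
- by move=> x; apply: fine_ge0; exact: Radon_Nikodym_SigmaFinite.f_ge0.
- apply/Lfun2P; split => //.
  rewrite (@ae_eq_Lnorm2 _ _ _ Pi _ (EFin \o (fine \o
    Radon_Nikodym (charge_of_finite_measure mu) Pi)))//.
  + exact/measurable_EFinP.
  + exact/measurable_EFinP.
  + apply: filterS (ae_eq_Radon_Nikodym_SigmaFinite muPi measurableT).
    by move=> x /= /[apply] <-.
- move=> A mA; rewrite (Radon_Nikodym_SigmaFinite.f_integral muPi)//.
  by apply: eq_integral => x _; rewrite /= fE.
Qed.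

Variable P : R.-pker (borel T) ~> (borel T).
Hypothesis revP : reversible P Pi.

Lemma spectral_gap_wasserstein (rho : R) : (0 <= rho)%R ->
  spectral_beta P Pi <= rho%:E ->
  forall mu : probability (borel T) R, has_L2_density mu Pi ->
    exists2 C : R, (0 < C)%R &
      forall t, wasserstein_min1 (kact mu (kiter P t)) Pi <= (C * rho ^+ t)%:E.
Proof.
move=> rho0 /(spectral_betaP revP rho0) gap mu /has_L2_densityP[h [h0 h2 muE]].
have /Lfun2P[_ Nh] := Lfun2_centered h2.
have NhE : (fine (N (centered Pi h)))%:E = N (centered Pi h).
  by rewrite fineK// ge0_fin_numE ?Lnorm_ge0.
(* the added 1 keeps the constant positive when mu = Pi *)
exists (fine (N (centered Pi h)) + 1)%R.
  by rewrite ltr_wpDl// fine_ge0 ?Lnorm_ge0.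
move=> t.
have mean1 s : mean Pi (iter s (mop P) h) = 1%R.
  have := kact_kiter_density revP s h0 h2 muE measurableT.
  by rewrite probability_setT /mean /Rintegral => <-.
have ht0 x := iter_mop_ge0 P t x h0.
have /Lfun2P[mht _] := Lfun2_iter_mop revP t h2.
apply: le_trans (wasserstein_le_Lnorm2 ht0 mht _) _.
  by move=> A mA; exact: kact_kiter_density.
have := gap_iter revP t rho0 gap h2 mean1.
rewrite {1}/centered mean1 => /le_trans; apply.
rewrite -NhE -EFinM lee_fin mulrC ler_wpM2r ?exprn_ge0//.
by rewrite lerDl.
Qed.

End forward.

(** * Bounded measurable functions *)

Section bounded_measurable.
Context d (T : measurableType d) (R : realType).
Implicit Types f g : T -> R.

Definition bounded_measurable f :=
  measurable_fun [set: T] f /\ exists M : R, forall x, (`|f x| <= M)%R.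

Lemma bounded_measurable_cst c : bounded_measurable (cst c).
Proof. by split => //; exists `|c|%R. Qed.

Lemma bounded_measurableD f g : bounded_measurable f -> bounded_measurable g ->
  bounded_measurable (f \+ g)%R.
Proof.
move=> [mf [M fM]] [mg [L gL]]; split; first exact: measurable_funD.
by exists (M + L)%R => x; rewrite (le_trans (ler_normD _ _))// lerD.
Qed.

Lemma bounded_measurableM f g : bounded_measurable f -> bounded_measurable g ->
  bounded_measurable (f \* g)%R.
Proof.
move=> [mf [M fM]] [mg [L gL]]; split; first exact: measurable_funM.
by exists (M * L)%R => x; rewrite normrM ler_pM.
Qed.

Lemma bounded_measurableZ k f : bounded_measurable f ->
  bounded_measurable (fun x => k * f x)%R.
Proof. exact: bounded_measurableM (bounded_measurable_cst k). Qed.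

Lemma bounded_measurableB f g : bounded_measurable f -> bounded_measurable g ->
  bounded_measurable (f \- g)%R.
Proof.
move=> [mf [M fM]] [mg [L gL]]; split; first exact: measurable_funB.
by exists (M + L)%R => x; rewrite (le_trans (ler_normB _ _))// lerD.
Qed.

Lemma bounded_measurable_integrable (mu : {measure set T -> \bar R}) f :
  mu [set: T] < +oo -> bounded_measurable f -> mu.-integrable [set: T] (EFin \o f).
Proof.
move=> mufin [mf [M fM]]; apply: measurable_bounded_integrable => //.
exists M; split; first exact: num_real.
by move=> N MN x _; apply: le_trans (fM x) _; exact: ltW.
Qed.

Lemma bounded_measurable_shift f : bounded_measurable f ->
  exists2 M : R, (0 < M)%R & forall x, (0 <= f x + M <= 2 * M)%R.
Proof.
move=> [_ [M fM]]; exists (`|M| + 1)%R; first by rewrite ltr_wpDl.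
by move=> x; have := fM x; have := ler_norm M; rewrite ler_norml; lra.
Qed.

End bounded_measurable.

Section mean_bounded.
Context d (T : measurableType d) (R : realType) (Pi : probability T R).
Implicit Types f g : T -> R.

Let bint f : bounded_measurable f -> Pi.-integrable [set: T] (EFin \o f).
Proof.
by apply: bounded_measurable_integrable; rewrite /= probability_setT ltry.
Qed.

Lemma meanE f : bounded_measurable f -> \int[Pi]_x (f x)%:E = (mean Pi f)%:E.
Proof.
by move=> bf; rewrite fineK//; apply: (integrable_fin_num measurableT); exact: bint.
Qed.

Lemma meanD f g : bounded_measurable f -> bounded_measurable g ->
  mean Pi (f \+ g)%R = (mean Pi f + mean Pi g)%R.
Proof. by move=> bf bg; apply: RintegralD => //; exact: bint. Qed.

Lemma meanB f g : bounded_measurable f -> bounded_measurable g ->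
  mean Pi (f \- g)%R = (mean Pi f - mean Pi g)%R.
Proof. by move=> bf bg; apply: RintegralB => //; exact: bint. Qed.

Lemma meanZ k f : bounded_measurable f -> mean Pi (fun x => k * f x)%R = (k * mean Pi f)%R.
Proof. by move=> bf; apply: RintegralZl => //; exact: bint. Qed.

Lemma mean_cst c : mean Pi (cst c) = c.
Proof. by rewrite /mean /Rintegral /= integral_cst//= probability_setT mule1. Qed.

Lemma mean_ge0 f : (forall x, 0 <= f x)%R -> (0 <= mean Pi f)%R.
Proof. by move=> f0; exact: Rintegral_ge0. Qed.

Lemma bounded_measurable_centered f : bounded_measurable f ->
  bounded_measurable (centered Pi f).
Proof. by move=> bf; apply: bounded_measurableB => //; exact: bounded_measurable_cst. Qed.

Lemma mean_centered f : bounded_measurable f -> mean Pi (centered Pi f) = 0%R.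
Proof.
move=> bf; rewrite meanB//; last exact: bounded_measurable_cst.
by rewrite mean_cst subrr.
Qed.

Lemma Lnorm2_bounded f : bounded_measurable f ->
  'N[Pi]_2%:E[EFin \o f] `^ 2 = (mean Pi (f \* f)%R)%:E.
Proof.
move=> bf; rewrite Lnorm2_real -meanE; last exact: bounded_measurableM.
by apply: eq_integral => x _; rewrite expr2.
Qed.

Lemma Lfun2_bounded f : bounded_measurable f -> f \in Lfun Pi 2%:E.
Proof.
move=> bf; apply/Lfun2P; split; first by case: bf.
by apply: (@lty_poweRy _ _ 2) => //; rewrite Lnorm2_bounded// ltry.
Qed.

Variable P : R.-pker T ~> T.

Lemma bounded_measurable_mop f : bounded_measurable f -> bounded_measurable (mop P f).
Proof.
move=> bf; have [mf [M fM]] := bf; split; first exact: measurable_mop.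
exists M => x; have Pf : (P x).-integrable [set: T] (EFin \o f).
  by apply: bounded_measurable_integrable => //; rewrite prob_kernel ltry.
rewrite -lee_fin -abse_EFin -integrable_markov_op//.
apply: le_trans; first by apply: le_abse_integral => //; exact/measurable_EFinP.
apply: (@le_trans _ _ (\int[P x]_y M%:E)).
  apply: ge0_le_integral => //.
    by apply: measurableT_comp => //; exact/measurable_EFinP.
  by move=> y _; rewrite lee_fin.
by rewrite integral_cst//= prob_kernel mule1.
Qed.

Let kint f x : bounded_measurable f -> (P x).-integrable [set: T] (EFin \o f).
Proof. by apply: bounded_measurable_integrable => //; rewrite prob_kernel ltry. Qed.

Lemma mop_bounded f x : bounded_measurable f -> markov_op P f x = (mop P f x)%:E.
Proof. by move=> bf; rewrite integrable_markov_op//; exact: kint. Qed.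

Lemma mop_affine k c f : bounded_measurable f ->
  mop P (fun x => k * f x + c)%R = (fun x => k * mop P f x + c)%R.
Proof.
move=> bf; apply/funext => x.
rewrite (@mopD _ _ _ P (fun x => k * f x)%R (cst c)) ?mop_cst.
- by congr (_ + _)%R; rewrite /mop /markov_op -RintegralZl//; exact: kint.
- exact/kint/bounded_measurableZ.
- exact/kint/bounded_measurable_cst.
Qed.

Lemma iter_mop_affine k c f t : bounded_measurable f ->
  iter t (mop P) (fun x => k * f x + c)%R = (fun x => k * iter t (mop P) f x + c)%R.
Proof.
move=> bf; elim: t => //= t ->; rewrite mop_affine//.
by elim: t => //= t; exact: bounded_measurable_mop.
Qed.

Lemma bounded_measurable_iter_mop f t : bounded_measurable f ->
  bounded_measurable (iter t (mop P) f).
Proof. by move=> bf; elim: t => //= t; exact: bounded_measurable_mop. Qed.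

Hypothesis revP : reversible P Pi.

Lemma mean_mop f : bounded_measurable f -> mean Pi (mop P f) = mean Pi f.
Proof.
move=> bf; have [M M0 fM] := bounded_measurable_shift bf.
have bfM : bounded_measurable (fun x => 1 * f x + M)%R.
  apply: bounded_measurableD; first exact: bounded_measurableZ.
  exact: bounded_measurable_cst.
have : mean Pi (mop P (fun x => 1 * f x + M)%R) = mean Pi (fun x => 1 * f x + M)%R.
  apply: EFin_inj; rewrite -!meanE//; last exact: bounded_measurable_mop.
  rewrite -(@reversible_invariant _ _ _ P Pi revP (fun x => (1 * f x + M)%:E)).
  - by apply: eq_integral => x _; rewrite -mop_bounded.
  - by move=> x; rewrite lee_fin mul1r; have /andP[] := fM x.
  - by apply/measurable_EFinP; case: bfM.
have bPf := bounded_measurable_mop bf.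
have bc := bounded_measurable_cst T M.
rewrite mop_affine// (meanD (bounded_measurableZ 1 bPf) bc).
rewrite (meanD (bounded_measurableZ 1 bf) bc) !meanZ//.
by move=> /addIr; rewrite !mul1r.
Qed.

(** [reversible_integral] concerns nonnegative functions; adding constants to f
    and g reduces to that case, and the extra terms cancel by invariance. *)
Lemma mean_mop_sym f g : bounded_measurable f -> bounded_measurable g ->
  mean Pi (mop P f \* g)%R = mean Pi (f \* mop P g)%R.
Proof.
move=> bf bg.
have [M M0 fM] := bounded_measurable_shift bf.
have [L L0 gL] := bounded_measurable_shift bg.
have bF (k : R) (h : T -> R) : bounded_measurable h -> bounded_measurable (fun x => 1 * h x + k)%R.
  move=> bh; apply: bounded_measurableD; first exact: bounded_measurableZ.
  exact: bounded_measurable_cst.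
pose F x := (1 * f x + M)%R; pose G x := (1 * g x + L)%R.
have : mean Pi (mop P F \* G)%R = mean Pi (F \* mop P G)%R.
  have bFG := bounded_measurableM (bounded_measurable_mop (bF M f bf)) (bF L g bg).
  have bGF := bounded_measurableM (bF M f bf) (bounded_measurable_mop (bF L g bg)).
  apply: EFin_inj; rewrite -(meanE bFG) -(meanE bGF).
  transitivity (\int[Pi]_x ((G x)%:E * markov_op P F x)).
    by apply: eq_integral => x _; rewrite EFinM muleC -(mop_bounded x (bF M f bf)).
  transitivity (\int[Pi]_x ((F x)%:E * markov_op P G x)); last first.
    by apply: eq_integral => x _; rewrite EFinM -(mop_bounded x (bF L g bg)).
  apply: (@reversible_integral _ _ _ P Pi revP G (EFin \o F) (2 * L)%R).
  - by move=> x; rewrite /G mul1r gL.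
  - by case: (bF L _ bg).
  - by move=> x; rewrite lee_fin /F mul1r; have /andP[] := fM x.
  - by apply/measurable_EFinP; case: (bF M _ bf).
have expand u v (a b : R) : bounded_measurable u -> bounded_measurable v ->
    mean Pi (fun x => (1 * u x + a) * (1 * v x + b))%R =
    (mean Pi (u \* v)%R + b * mean Pi u + a * mean Pi v + a * b)%R.
  move=> bu bv; rewrite -(meanZ b bu) -(meanZ a bv) -[X in _ = (_ + X)%R]mean_cst.
  have buv := bounded_measurableM bu bv.
  have bbu := bounded_measurableZ b bu; have bav := bounded_measurableZ a bv.
  have buvb := bounded_measurableD buv bbu.
  rewrite -(meanD buv bbu) -(meanD buvb bav).
  rewrite -(meanD (bounded_measurableD buvb bav) (bounded_measurable_cst T _)).
  by congr mean; apply/funext => x /=; lra.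
rewrite !mop_affine// !expand//; do ?exact: bounded_measurable_mop.
by rewrite !mean_mop//; lra.
Qed.

(** The factors of P move across the inner product one at a time. *)
Lemma mean_iter_mop_sym f g s t : bounded_measurable f -> bounded_measurable g ->
  mean Pi (iter (s + t) (mop P) f \* g)%R =
  mean Pi (iter t (mop P) f \* iter s (mop P) g)%R.
Proof.
move=> bf; elim: s g => // s IH g bg.
rewrite addSn iterS mean_mop_sym//; last exact: bounded_measurable_iter_mop.
by rewrite IH -?iterSr//; exact: bounded_measurable_mop.
Qed.

End mean_bounded.

(** * From decay of correlations to contraction *)

(** The increments of a convex sequence are nondecreasing, so a positive first
    increment would force linear growth. *)
Lemma bounded_convex_seq_le (R : realType) (c : nat -> R) (M : R) :
  (forall s, 2 * c s.+1 <= c s + c s.+2)%R -> (forall s, c s.+1 <= M)%R ->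
  (c 1%N <= c 0%N)%R.
Proof.
move=> cvx cM; rewrite leNgt; apply/negP => c01.
set D := (c 1%N - c 0%N)%R; have D0 : (0 < D)%R by rewrite subr_gt0.
have incr s : (D <= c s.+1 - c s)%R.
  elim: s => [|s IH]; first exact: lexx.
  by apply: le_trans IH _; have := cvx s; lra.
have lin s : (c 1%N + s%:R * D <= c s.+1)%R.
  elim: s => [|s IH]; first by rewrite mul0r addr0.
  by have := incr s.+1; rewrite -natr1; lra.
have := lin (Num.truncn ((M - c 1%N) / D)).+1.
apply/negP; rewrite -ltNge; apply: le_lt_trans (cM _) _.
by rewrite -ltrBlDl -ltr_pdivrMr//; exact: truncnS_gt.
Qed.

Lemma lee_sqr_poweR (R : realType) (x y : \bar R) :
  0 <= x -> 0 <= y -> x `^ 2 <= y `^ 2 -> x <= y.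
Proof.
move=> x0 y0 xy; rewrite -(poweRe1 x0) -(poweRe1 y0) -(@mulfV R 2)//.
rewrite !poweRrM; apply: gt0_ler_poweR; rewrite ?in_itv/= ?leey ?andbT ?poweR_ge0//.
Qed.

Section decay.
Context d (T : measurableType d) (R : realType).
Variables (P : R.-pker T ~> T) (Pi : probability T R).
Hypothesis revP : reversible P Pi.

(** With u = P^s f and w = P^(s+2) f, self-adjointness gives
    ||P^(s+1) f||^2 = <u, w>, and the nonnegativity of ||rho u - w / rho||^2 is
    exactly the convexity of s |-> ||P^s f||^2 / rho^(2 s). *)
Lemma correlation_decay_contraction (f : T -> R) (rho C : R) :
  (0 < rho)%R -> bounded_measurable f ->
  (forall t, (0 < t)%N ->
    mean Pi (iter t (mop P) f \* f)%R <= C * rho ^+ t)%R ->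
  (mean Pi (mop P f \* mop P f)%R <= rho ^+ 2 * mean Pi (f \* f)%R)%R.
Proof.
move=> rho0 bf decay.
pose a s := mean Pi (iter s (mop P) f \* iter s (mop P) f)%R.
pose c s := (a s / rho ^+ (s + s))%R.
have biter s := bounded_measurable_iter_mop P s bf.
have rhoN0 n : (0 < rho ^+ n)%R by exact: exprn_gt0.
have cM s : (c s.+1 <= C)%R.
  rewrite /c ler_pdivrMr// /a -mean_iter_mop_sym//.
  by apply: decay; rewrite addnS.
have cvx s : (2 * c s.+1 <= c s + c s.+2)%R.
  set u := iter s (mop P) f; set w := iter s.+2 (mop P) f.
  have aE : a s.+1 = mean Pi (u \* w)%R.
    rewrite /a /w; have := mean_mop_sym revP (biter s) (biter s.+1).
    by [].
  pose q := (rho^-1)%R; have rq : (rho * q = 1)%R by rewrite mulfV// gt_eqF.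
  have : (0 <= mean Pi (fun x => (rho * u x - q * w x) ^+ 2))%R.
    by apply: mean_ge0 => x; exact: sqr_ge0.
  have -> : (fun x => (rho * u x - q * w x) ^+ 2)%R =
      ((fun x => rho ^+ 2 * (u x * u x)) \- (fun x => 2 * (u x * w x)) \+
       (fun x => q ^+ 2 * (w x * w x)))%R.
    apply/funext => x /=.
    have -> : (2 * (u x * w x) = 2 * (rho * q) * (u x * w x))%R by rewrite rq mulr1.
    by ring.
  have buu := bounded_measurableM (biter s) (biter s).
  have buw := bounded_measurableM (biter s) (biter s.+2).
  have bww := bounded_measurableM (biter s.+2) (biter s.+2).
  have bZ k g bg := @bounded_measurableZ _ T R k g bg.
  rewrite (meanD _ (bounded_measurableB (bZ _ _ buu) (bZ _ _ buw)) (bZ _ _ bww)).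
  rewrite (meanB _ (bZ _ _ buu) (bZ _ _ buw)) (meanZ _ _ buu) (meanZ _ _ buw).
  rewrite (meanZ _ _ bww) -aE -[mean Pi (u \* u)%R]/(a s) -[mean Pi (w \* w)%R]/(a s.+2).
  move=> h; rewrite -subr_ge0 /c.
  have -> : (a s / rho ^+ (s + s) + a s.+2 / rho ^+ (s.+2 + s.+2) -
      2 * (a s.+1 / rho ^+ (s.+1 + s.+1)) =
      (rho ^+ 2 * a s - 2 * a s.+1 + q ^+ 2 * a s.+2) /
        (rho ^+ (s + s) * rho ^+ 2))%R.
    rewrite !addnS !addSn !exprS /q; field.
    by rewrite gt_eqF// gt_eqF.
  by rewrite divr_ge0// mulr_ge0// ltW.
have := bounded_convex_seq_le cvx cM.
by rewrite /c addnn addn0 expr0 divr1 ler_pdivrMr// mulrC.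
Qed.

Lemma decay_gap (f : T -> R) (rho C : R) :
  (0 < rho)%R -> bounded_measurable f ->
  (forall t, (0 < t)%N ->
    mean Pi (iter t (mop P) (centered Pi f) \* centered Pi f)%R <= C * rho ^+ t)%R ->
  'N[Pi]_2%:E[EFin \o (mop P f \- cst (mean Pi f))%R] <=
  rho%:E * 'N[Pi]_2%:E[EFin \o centered Pi f].
Proof.
move=> rho0 bf decay; have bcf := bounded_measurable_centered Pi bf.
rewrite Lnorm2_mop_center//; last exact: Lfun2_bounded.
have := correlation_decay_contraction rho0 bcf decay.
rewrite -lee_fin EFinM -(Lnorm2_bounded Pi (bounded_measurable_mop P bcf)).
rewrite -(Lnorm2_bounded Pi bcf) => sqr_le.
apply: lee_sqr_poweR; rewrite ?mule_ge0 ?Lnorm_ge0 ?lee_fin ?(ltW rho0)//.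
rewrite poweRM ?Lnorm_ge0 ?lee_fin ?(ltW rho0)//.
by rewrite poweR_EFin powR_mulrn// ltW.
Qed.

End decay.

(** * Lipschitz test functions *)

Section lipschitz.
Context (R : realType) (T : pointedMetricType R).
Implicit Types (mu nu : probability (borel T) R) (phi : borel T -> R).

(** Lipschitz for the bounded distance min(d, 1): up to the constant, this means
    bounded and Lipschitz for d. *)
Definition cost_lipschitz (K : R) phi :=
  forall x y : T, (`|phi x - phi y| <= K * cost (x, y))%R.

Lemma cost_lipschitz_bounded_measurable K phi : (0 < K)%R ->
  cost_lipschitz K phi -> bounded_measurable phi.
Proof.
move=> K0 lphi; split; last first.
  exists (`|phi point| + K)%R => x.
  have := lphi x point; have := cost_le1 (x, point : T) => c1 lx.
  rewrite -(subrK (phi point) (phi x)) addrC (le_trans (ler_normD _ _))//.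
  by rewrite lerD2l (le_trans lx)// ler_piMr// ltW.
apply: (measurability _ (RGenInftyO.measurableE R)) => _ [_ [a ->] <-].
rewrite setTI; apply: sub_sigma_algebra.
rewrite openE => x /=; rewrite in_itv/= => xa.
set e := ((a - phi x) / K)%R.
have e0 : (0 < e)%R by rewrite divr_gt0// subr_gt0.
rewrite /interior /=; apply/nbhs_ballP; exists e => // y; rewrite ballEmdist/= => xy.
rewrite in_itv/=.
have := lphi x y; have : (K * cost (x, y) < a - phi x)%R.
  rewrite mulrC -ltr_pdivlMr//; apply: le_lt_trans xy.
  by rewrite /cost /= ge_min lexx.
by move=> h1 h2; have := le_lt_trans h2 h1; rewrite ltr_norml; lra.
Qed.

Lemma coupling_mean mu nu (Gamma : probability (borel (T * T)%type) R) phi :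
  is_coupling mu nu Gamma -> bounded_measurable phi ->
  (mean mu phi - mean nu phi = mean Gamma (fun z => phi z.1 - phi z.2))%R.
Proof.
move=> [Gmu Gnu] bphi.
have [mphi [M phiM]] := bphi.
have marginal (proj : borel (T * T)%type -> borel T) (lam : probability (borel T) R) :
    measurable_fun [set: borel (T * T)%type] proj ->
    (forall B : set (borel T), measurable B -> Gamma (proj @^-1` B) = lam B) ->
    bounded_measurable (phi \o proj) /\ mean lam phi = mean Gamma (phi \o proj).
  move=> mproj projE.
  have bpp : bounded_measurable (phi \o proj).
    by split; [exact: measurableT_comp|exists M => z /=].
  split=> //; apply: EFin_inj; rewrite -(meanE _ bphi) -(meanE _ bpp).
  rewrite -[RHS](@integral_pushforward _ _ _ _ R proj mproj Gamma setT (EFin \o phi))//.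
  - by apply: eq_measure_integral => B mB _; exact/esym/projE.
  - exact/measurable_EFinP.
  - by apply: bounded_measurable_integrable => //=; rewrite probability_setT ltry.
have [b1 ->] := marginal fst mu (@measurable_fst_borel R T) Gmu.
have [b2 ->] := marginal snd nu (@measurable_snd_borel R T) Gnu.
by rewrite -meanB.
Qed.

(** The easy half of Kantorovich duality: phi z.1 - phi z.2 is at most K times
    the cost, whatever the coupling. *)
Lemma wasserstein_duality mu nu K phi (w : R) : (0 < K)%R ->
  cost_lipschitz K phi -> wasserstein_min1 mu nu <= w%:E ->
  (`|mean mu phi - mean nu phi| <= K * w)%R.
Proof.
move=> K0 lphi; have bphi := cost_lipschitz_bounded_measurable K0 lphi.
rewrite mulrC -ler_pdivrMr// -lee_fin => /(le_trans _); apply.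
apply: le_ereal_inf_tmp => _ [Gamma cG <-]; rewrite (coupling_mean cG bphi).
have bcost : bounded_measurable (@cost R T : borel (T * T)%type -> R).
  split; first exact: measurable_cost.
  by exists 1%R => z; rewrite ger0_norm ?cost_ge0 ?cost_le1.
rewrite -[X in _ <= X]/(\int[Gamma]_z (cost z)%:E) (meanE _ bcost) lee_fin.
rewrite ler_pdivrMr// mulrC -(meanZ _ _ bcost).
have Gfin : Gamma [set: _] < +oo by rewrite probability_setT ltry.
have bphi12 : bounded_measurable ((fun z => phi z.1 - phi z.2)%R :
    borel (T * T)%type -> R).
  have [mphi [M phiM]] := bphi; apply: bounded_measurableB.
  - by split; [exact: measurableT_comp (@measurable_fst_borel R T)|exists M => z /=].
  - by split; [exact: measurableT_comp (@measurable_snd_borel R T)|exists M => z /=].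
have i12 := bounded_measurable_integrable Gfin bphi12.
apply: le_trans (le_normr_Rintegral measurableT i12) _.
apply: le_Rintegral => //.
- exact: integrable_norm.
- by apply: bounded_measurable_integrable => //; exact: bounded_measurableZ.
Qed.

End lipschitz.

(** * The gap inequality for Lipschitz functions *)

Section bounded_density.
Context d (T : measurableType d) (R : realType) (Pi : probability T R).

Lemma bounded_density_probability (h : T -> R) :
  (forall x, 0 <= h x)%R -> bounded_measurable h -> mean Pi h = 1%R ->
  exists2 mu : probability T R, has_L2_density mu Pi &
    forall A, measurable A -> mu A = \int[Pi]_(x in A) (h x)%:E.
Proof.
move=> h0 bh h1; have [mh _] := bh.
have dT : density Pi h0 mh [set: T] = 1 by rewrite densityE// meanE// h1.
pose D : probability T R :=
  HB.pack (density Pi h0 mh) (Measure_isProbability.Build _ _ _ (density Pi h0 mh) dT).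
have DE A : measurable A -> D A = \int[Pi]_(x in A) (h x)%:E.
  by move=> mA; exact: densityE.
exists D => //.
have DPi : D `<< Pi.
  apply/null_content_dominatesP => A mA PiA0; rewrite DE// null_set_integral//.
  by apply: measurable_funTS; exact/measurable_EFinP.
split => //.
have /Lfun2P[_ Nh] := Lfun2_bounded Pi bh.
have mdD : measurable_fun [set: T]
    (fine \o Radon_Nikodym (charge_of_finite_measure D) Pi).
  exact: measurableT_comp.
apply/Lfun2P; split => //.
rewrite (@ae_eq_Lnorm2 _ _ _ Pi _ (EFin \o h))//.
- exact/measurable_EFinP.
- exact/measurable_EFinP.
- have : ae_eq Pi setT (Radon_Nikodym (charge_of_finite_measure D) Pi) (EFin \o h).
    apply: integral_ae_eq => //.
    + exact: Radon_Nikodym_integrable.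
    + exact/measurable_EFinP.
    + by move=> E _ mE; rewrite -Radon_Nikodym_integral// -DE.
  by apply: filterS => x /= /[apply] ->.
Qed.

Lemma mean_has_density (nu : probability T R) (h f : T -> R) :
  (forall x, 0 <= h x)%R -> bounded_measurable h ->
  (forall A, measurable A -> nu A = \int[Pi]_(x in A) (h x)%:E) ->
  bounded_measurable f -> mean nu f = mean Pi (h \* f)%R.
Proof.
move=> h0 bh nuE bf; have [M M0 fM] := bounded_measurable_shift bf.
have [mh _] := bh.
have bM := bounded_measurable_cst T M.
have bfM := bounded_measurableD bf bM.
have bhf := bounded_measurableM bh bf.
have meanh : mean Pi h = 1%R.
  by apply: EFin_inj; rewrite -meanE// -nuE// probability_setT.
have : mean nu (f \+ cst M)%R = mean Pi (h \* (f \+ cst M))%R.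
  apply: EFin_inj; rewrite -(meanE _ bfM) -(meanE _ (bounded_measurableM bh bfM)).
  rewrite (integral_has_density h0 mh nuE) //.
  - by move=> x; rewrite lee_fin; have /andP[] := fM x.
  - by apply/measurable_EFinP; case: bfM.
rewrite (meanD _ bf bM) mean_cst.
have -> : (h \* (f \+ cst M) = (h \* f) \+ (fun x => M * h x))%R.
  by apply/funext => x /=; rewrite mulrDr [(M * _)%R]mulrC.
rewrite (meanD _ bhf (bounded_measurableZ M bh)) (meanZ _ _ bh) meanh mulr1.
exact: addIr.
Qed.

End bounded_density.

Section lipschitz_gap.
Context (R : realType) (T : pointedMetricType R).
Variables (Pi : probability (borel T) R) (P : R.-pker (borel T) ~> (borel T)).
Hypothesis revP : reversible P Pi.

(** Start the chain from the law of density h = 1 + f / M, where f is phi minus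
    its mean, and test against f: since P^t h = 1 + P^t f / M, the integral of f
    under the law at time t is <P^t f, f> / M. *)
Lemma lipschitz_gap (rho K : R) (phi : borel T -> R) : (0 < rho)%R ->
  (forall mu : probability (borel T) R, has_L2_density mu Pi ->
    exists2 C : R, (0 < C)%R & forall t, (0 < t)%N ->
      wasserstein_min1 (kact mu (kiter P t)) Pi <= (C * rho ^+ t)%:E) ->
  (0 < K)%R -> cost_lipschitz K phi ->
  'N[Pi]_2%:E[EFin \o (mop P phi \- cst (mean Pi phi))%R] <=
  rho%:E * 'N[Pi]_2%:E[EFin \o centered Pi phi].
Proof.
move=> rho0 conv K0 lphi; have bphi := cost_lipschitz_bounded_measurable K0 lphi.
pose f := centered Pi phi; have bf := bounded_measurable_centered Pi bphi.
have lf : cost_lipschitz K f.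
  by move=> x y; rewrite /f /centered /= opprB addrA subrK; exact: lphi.
have meanf : mean Pi f = 0%R by exact: mean_centered.
have [M M0 fM] := bounded_measurable_shift bf.
pose h x := (M^-1 * f x + 1)%R.
have bh : bounded_measurable h.
  apply: bounded_measurableD; first exact: bounded_measurableZ.
  exact: bounded_measurable_cst.
have h0 x : (0 <= h x)%R.
  have -> : h x = ((f x + M) / M)%R by rewrite /h; field; rewrite gt_eqF.
  by apply: divr_ge0; [have /andP[] := fM x|exact: ltW].
have h1 : mean Pi h = 1%R.
  rewrite (meanD _ (bounded_measurableZ M^-1 bf) (bounded_measurable_cst _ 1%R)).
  by rewrite (meanZ _ _ bf) meanf mulr0 add0r mean_cst.
have [mu mu2 muE] := bounded_density_probability h0 bh h1.
have [C C0 Ct] := conv mu mu2.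
apply: (@decay_gap _ _ _ P Pi revP phi rho (M * (K * C))%R) => // t t0.
rewrite -/f.
have := wasserstein_duality K0 lf (Ct t t0).
have bPf := bounded_measurable_iter_mop P t bf.
have iterh : iter t (mop P) h = (fun x => M^-1 * iter t (mop P) f x + 1)%R.
  by rewrite iter_mop_affine.
rewrite (@mean_has_density _ _ _ Pi _ (iter t (mop P) h) f) ?meanf ?subr0//; last 3 first.
- by move=> x; exact: iter_mop_ge0.
- exact: bounded_measurable_iter_mop.
- by move=> A mA; apply: kact_kiter_density => //; exact: Lfun2_bounded.
have -> : (iter t (mop P) h \* f = (fun x => M^-1 * (iter t (mop P) f \* f) x) \+ f)%R.
  by rewrite iterh; apply/funext => x /=; ring.
have bPff := bounded_measurableM bPf bf.
rewrite (meanD _ (bounded_measurableZ M^-1 bPff) bf) (meanZ _ _ bPff) meanf addr0.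
move=> /(le_trans (ler_norm _)); rewrite mulrC ler_pdivrMr//.
by move=> /le_trans; apply; rewrite mulrC !mulrA.
Qed.

End lipschitz_gap.

(** * Induction principle for L2 *)

Section L2_density.
Context d (T : measurableType d) (R : realType) (Pi : probability T R).
Local Notation N f := ('N[Pi]_2%:E[EFin \o f]).
Import HBNNSimple.

(** Dominated convergence for the square of f - f_n. *)
Lemma Lnorm2_dominated (f_ : (T -> R)^nat) (f g : T -> R) (e : R) :
  (forall n, measurable_fun [set: T] (f_ n)) -> measurable_fun [set: T] f ->
  g \in Lfun Pi 2%:E -> (forall x, f_ n x @[n --> \oo] --> f x) ->
  (forall n x, `|f x - f_ n x| <= g x)%R -> (0 < e)%R ->
  exists n, N (f \- f_ n)%R < e%:E.
Proof.
move=> mf_ mf g2 f_f fg e0.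
pose F n x := ((f x - f_ n x) ^+ 2)%:E.
have mF n : measurable_fun [set: T] (F n).
  by apply/measurable_EFinP; apply: measurable_funX; exact: measurable_funB.
have Fcvg x : F ^~ x @ \oo --> (0 : \bar R).
  apply: cvg_EFin; first exact: nearW.
  rewrite (_ : 0%R = ((f x - f x) * (f x - f x))%R); last by rewrite subrr mulr0.
  rewrite [X in X @ _ --> _](_ : _ = (fun n => (f x - f_ n x) * (f x - f_ n x))%R).
    by apply: cvgM; apply: cvgB => //; exact: cvg_cst.
  by apply/funext => n /=; rewrite expr2.
have Fg x n : [set: T] x -> `|F n x| <= (g x ^+ 2)%:E.
  move=> _; rewrite /F abse_EFin lee_fin ger0_norm ?sqr_ge0//.
  rewrite -real_normK ?num_real// ler_pXn2r ?nnegrE//.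
  exact: le_trans (fg n x).
have [_ _] := dominated_convergence measurableT mF (measurable_cst (0 : \bar R))
  (aeW Pi (fun x _ => Fcvg x)) (Lfun2_integrable_sqr g2) (aeW Pi Fg).
rewrite integral0 => intF.
apply: contrapT => /forallNP /= h.
have : (e ^+ 2)%:E <= (0 : \bar R).
  rewrite -(cvg_lim _ intF)//; apply: lime_ge; first by apply/cvg_ex; eexists; exact: intF.
  apply: nearW => n /=; have /negP := h n; rewrite -leNgt => eN.
  rewrite -(Lnorm2_real Pi (f \- f_ n)%R) -powR_mulrn ?(ltW e0)// -poweR_EFin.
  by apply: gt0_ler_poweR; rewrite ?in_itv/= ?leey ?andbT ?Lnorm_ge0 ?lee_fin ?(ltW e0).
by rewrite lee_fin leNgt exprn_gt0.
Qed.

Section induction.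
Variables (G : set (set T)) (V : (T -> R) -> Prop).
Hypotheses (measurableG : @measurable _ T = <<s G >>) (GI : setI_closed G).
Hypothesis V1 : V (cst 1%R).
Hypothesis VD : forall (k : R) f g, V f -> V g -> V (fun x => k * f x + g x)%R.
Hypothesis Vlim : forall f, f \in Lfun Pi 2%:E ->
  (forall e : R, (0 < e)%R -> exists2 g, V g & N (f \- g)%R < e%:E) -> V f.
Hypothesis VG : forall A, G A -> V \1_A.

Let V0 : V (cst 0%R).
Proof.
rewrite (_ : cst 0%R = (fun x => -1 * cst 1 x + cst 1 x)%R); first exact: VD.
by apply/funext => x /=; rewrite mulr1 addNr.
Qed.

Let Lfun2_indic A : measurable A -> (\1_A : T -> R) \in Lfun Pi 2%:E.
Proof.
move=> mA; apply: Lfun2_bounded; split; first exact: measurable_indic.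
by exists 1%R => x; rewrite indicE ger0_norm//; case: (_ \in _); rewrite ?lexx ?ler01.
Qed.

(** The sets whose indicator satisfies V form a Dynkin system: a countable
    disjoint union is the L2 limit of its finite subunions. *)
Let V_indic A : measurable A -> V \1_A.
Proof.
move=> mA; apply: (dynkin_induction (P := fun A => V \1_A) measurableG GI) => //.
- by rewrite indicT.
- move=> S mS VS; rewrite (_ : \1_(~` S) = (fun x => -1 * \1_S x + cst 1 x)%R).
    exact: VD.
  apply/funext => x; rewrite !indicE in_setC /=.
  by case: (x \in S); rewrite /= ?mulr1 ?mulr0 ?addNr ?add0r.
- move=> F mF tF VF.
  pose U n := \big[setU/set0]_(i < n) F i.
  have mU n : measurable (U n) by exact: bigsetU_measurable.
  have VU n : V \1_(U n).
    elim: n => [|n IH]; first by rewrite /U big_ord0 indic0.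
    rewrite (_ : \1_(U n.+1) = (fun x => 1 * \1_(U n) x + \1_(F n) x)%R).
      exact: VD.
    have disj : U n `&` F n = set0.
      rewrite /U -bigcup_mkord; apply/seteqP; split => // x [[i /= ni Fix] Fnx].
      move/trivIsetP : tF => /(_ i n Logic.I Logic.I) FiFn.
      have iN : i != n by rewrite ltn_eqF.
      by have : (F i `&` F n) x by []; rewrite FiFn.
    apply/funext => x; rewrite mul1r /U big_ord_recr/= -/(U n) !indicE in_setU.
    have [xU|xU] := boolP (x \in U n); have [xF|xF] := boolP (x \in F n);
      rewrite ?addr0 ?add0r//=.
    by have : set0 x by rewrite -disj; split; exact/set_mem.
  apply: Vlim => [|e e0]; first by apply: Lfun2_indic; exact: bigcup_measurable.
  have mUF : measurable (\bigcup_k F k) by exact: bigcup_measurable.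
  have [n Ne] : exists n, N (\1_(\bigcup_k F k) \- \1_(U n))%R < e%:E.
    apply: (@Lnorm2_dominated (fun n => \1_(U n)) _ (cst 1%R)) => //.
    - exact: Lfun_cst.
    - move=> x; apply: cvg_near_cst.
      have [[k _ Fkx]|nFx] := pselect ((\bigcup_k F k) x).
        exists k.+1 => // n /= kn; rewrite !indicE !mem_set//; first by exists k.
        by rewrite /U -bigcup_mkord; exists k.
      apply: nearW => n; rewrite !indicE !memNset//.
      by rewrite /U -bigcup_mkord => -[k _ Fkx]; apply: nFx; exists k.
    - move=> n x; rewrite !indicE /=.
      by do 2 case: (_ \in _); rewrite /= ?subrr ?subr0 ?sub0r ?normrN ?normr0 ?normr1 ?lexx ?ler01.
  by exists (\1_(U n)).
- by rewrite -measurableG.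
Qed.

Let V_nnsfun (h : {nnsfun T >-> R}) : V h.
Proof.
rewrite (_ : (h : T -> R) = (fun x => \sum_(r <- finmap.enum_fset (fset_set (range h)))
    (r * \1_(h @^-1` [set r]) x))%R); last first.
  by apply/funext => x; rewrite fimfunE fsbig_finite.
elim: (finmap.enum_fset _) => [|r s IH].
  by rewrite (_ : (fun _ => _) = cst 0%R)//; apply/funext => x; rewrite big_nil.
under eq_fun do rewrite big_cons.
by apply: VD => //; exact: V_indic.
Qed.

(** A nonnegative function dominates its approximations from below by simple
    functions, which therefore converge in L2. *)
Let V_ge0 (f : T -> R) : (forall x, 0 <= f x)%R -> f \in Lfun Pi 2%:E -> V f.
Proof.
move=> f0 f2; apply: Vlim => // e e0; have /Lfun2P[mf _] := f2.
have mEf : measurable_fun [set: T] (EFin \o f) by exact/measurable_EFinP.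
have Ef0 x : [set: T] x -> 0 <= (EFin \o f) x by rewrite lee_fin.
pose h := nnsfun_approx measurableT mEf.
have [n Ne] : exists n, N (f \- h n)%R < e%:E.
  apply: (@Lnorm2_dominated (fun n => h n) f f) => //.
  - by move=> x; exact: (fine_cvg (cvg_nnsfun_approx measurableT mEf Ef0 (I : setT x))).
  - move=> n x; have := le_approx n Ef0 (I : [set: T] x); rewrite -nnsfun_approxE.
    rewrite lee_fin => hf; rewrite ger0_norm ?subr_ge0// lerBlDr lerDl.
    exact: fun_ge0.
by exists (h n) => //; exact: V_nnsfun.
Qed.

(** A closed linear condition that holds for the constant 1 and for the
    indicators of a generating pi-system holds on all of L2. *)
Lemma Lfun2_induction (f : T -> R) : f \in Lfun Pi 2%:E -> V f.
Proof.
move=> f2; have /Lfun2P[mf Nf] := f2.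
have part (g : T -> R) : measurable_fun [set: T] g ->
    (forall x, `|g x| <= `|f x|)%R -> g \in Lfun Pi 2%:E.
  move=> mg gf; apply/Lfun2P; split => //; apply: le_lt_trans Nf.
  apply: le_Lnorm2; [exact/measurable_EFinP|exact/measurable_EFinP|].
  by move=> x; rewrite lee_fin.
rewrite (_ : f = (fun x => -1 * f^\- x + f^\+ x)%R).
  apply: VD; apply: V_ge0 => //; apply: part.
  - exact: measurable_funrneg.
  - move=> x; rewrite (ger0_norm (funrneg_ge0 _ _)) /funrneg ge_max normr_ge0 andbT.
    by rewrite -normrN ler_norm.
  - exact: measurable_funrpos.
  - move=> x; rewrite (ger0_norm (funrpos_ge0 _ _)) /funrpos ge_max normr_ge0 andbT.
    exact: ler_norm.
apply/funext => x; rewrite mulN1r addrC.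
by rewrite -{1}[f]funrposBneg.
Qed.

End induction.

End L2_density.

(** * Density of Lipschitz functions and conclusion *)

Lemma Lnorm2Z d (T : measurableType d) (R : realType) (Pi : {measure set T -> \bar R})
    (k : R) (f : T -> R) : measurable_fun [set: T] f ->
  'N[Pi]_2%:E[EFin \o (fun x => k * f x)%R] = `|k|%:E * 'N[Pi]_2%:E[EFin \o f].
Proof.
move=> mf; rewrite unlock /=.
under eq_integral do rewrite normrM powRM// EFinM.
rewrite ge0_integralZl//; last first.
  by apply/measurable_EFinP; apply: (measurableT_comp (measurable_powR _));
    exact: measurableT_comp.
rewrite poweRM ?lee_fin ?powR_ge0//; last first.
  by apply: integral_ge0 => x _; rewrite lee_fin powR_ge0.
by rewrite poweR_EFin -powRrM mulfV// powRr1.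
Qed.

Section lipschitz_density.
Context (R : realType) (T : pointedMetricType R) (Pi : probability (borel T) R).
Local Notation N f := ('N[Pi]_2%:E[EFin \o f]).

Lemma cost_sym (x y : T) : cost (x, y) = cost (y, x).
Proof. by rewrite /cost /= metric_sym. Qed.

Lemma cost_triangle (x y z : T) : (cost (x, z) <= cost (x, y) + cost (y, z))%R.
Proof.
have := metric_triangle x y z; rewrite /cost /=.
have := mdist_ge0 x y; have := mdist_ge0 y z.
by case: (leP (mdist x z) 1%R); case: (leP (mdist x y) 1%R);
  case: (leP (mdist y z) 1%R); lra.
Qed.

(** The distance to C for the cost min(d, 1), which is bounded and Lipschitz. *)
Definition cost_to (C : set T) (x : T) : R := inf [set cost (x, y) | y in C].

Lemma cost_to_le C x y : C y -> (cost_to C x <= cost (x, y))%R.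
Proof.
move=> Cy; apply: ge_inf; last by exists y.
by exists 0%R => _ [z _ <-]; exact: cost_ge0.
Qed.

Lemma le_cost_to C x a : C !=set0 -> (forall y, C y -> a <= cost (x, y))%R ->
  (a <= cost_to C x)%R.
Proof.
move=> [c Cc] aC; apply: lb_le_inf; first by exists (cost (x, c)); exists c.
by move=> _ [y Cy <-]; exact: aC.
Qed.

Lemma cost_to_lipschitz C : C !=set0 -> cost_lipschitz 1%R (cost_to C).
Proof.
move=> C0.
have half x y : (cost_to C x - cost_to C y <= cost (x, y))%R.
  rewrite lerBlDr -lerBlDl; apply: le_cost_to => // z Cz.
  by have := cost_to_le x Cz; have := cost_triangle x y z; lra.
move=> x y; rewrite mul1r ler_norml half andbT lerNl opprB cost_sym.
exact: half.
Qed.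

Definition lipschitz_approximable (f : borel T -> R) :=
  measurable_fun [set: borel T] f /\ forall e : R, (0 < e)%R ->
    exists2 phi : borel T -> R, (exists2 K : R, (0 < K)%R & cost_lipschitz K phi) &
      N (f \- phi)%R < e%:E.

Let lipschitz_measurable K (phi : borel T -> R) : (0 < K)%R ->
  cost_lipschitz K phi -> measurable_fun [set: borel T] phi.
Proof. by move=> K0 /(cost_lipschitz_bounded_measurable K0)[]. Qed.

Lemma lipschitz_approximable_cst c : lipschitz_approximable (cst c).
Proof.
split => // e e0; exists (cst c).
  by exists 1%R => // x y; rewrite subrr normr0 mul1r cost_ge0.
rewrite (_ : (_ \- _)%R = cst 0%R); last by apply/funext => x /=; rewrite subrr.
by rewrite (Lnorm2_cst (probability_setT Pi)) normr0 lte_fin.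
Qed.

Lemma lipschitz_approximable_affine (k : R) f g : lipschitz_approximable f ->
  lipschitz_approximable g -> lipschitz_approximable (fun x => k * f x + g x)%R.
Proof.
move=> [mf af] [mg ag]; split.
  by apply: measurable_funD => //; exact: measurable_funM.
move=> e e0.
have k0 : (0 < `|k| + 1)%R by rewrite ltr_wpDl.
have e20 : (0 < e / 2)%R by rewrite divr_gt0.
have [phi [K K0 Kphi] fphi] := af (e / 2 / (`|k| + 1))%R (divr_gt0 e20 k0).
have [psi [L L0 Lpsi] gpsi] := ag (e / 2)%R e20.
have mphi := lipschitz_measurable K0 Kphi; have mpsi := lipschitz_measurable L0 Lpsi.
have mfphi : measurable_fun [set: borel T] (f \- phi)%R by exact: measurable_funB.
have mgpsi : measurable_fun [set: borel T] (g \- psi)%R by exact: measurable_funB.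
exists (fun x => k * phi x + psi x)%R.
  exists (`|k| * K + L)%R => [|x y]; first by rewrite ltr_wpDl// mulr_ge0// ltW.
  rewrite (_ : (_ - _)%R = (k * (phi x - phi y) + (psi x - psi y))%R); last by ring.
  by rewrite (le_trans (ler_normD _ _))// normrM mulrDl -mulrA lerD// ler_wpM2l.
rewrite (_ : (_ \- _)%R = ((fun x => k * (f \- phi) x) \+ (g \- psi))%R); last first.
  by apply/funext => x /=; ring.
apply: le_lt_trans; first by apply: Lnorm2D => //; exact: measurable_funM.
rewrite (splitr e) (EFinD (e / 2)) Lnorm2Z//.
apply: lteD => //.
apply: (@le_lt_trans _ _ ((`|k| + 1)%:E * N (f \- phi)%R)).
  by apply: lee_wpmul2r; rewrite ?Lnorm_ge0// lee_fin lerDl.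
have kfin : (`|k| + 1)%:E \is a fin_num by [].
move: fphi; rewrite -(lte_pmul2l kfin) ?lte_fin//.
by rewrite -EFinM mulrC divfK// gt_eqF.
Qed.

Lemma lipschitz_approximable_lim (f : borel T -> R) : f \in Lfun Pi 2%:E ->
  (forall e : R, (0 < e)%R ->
    exists2 g, lipschitz_approximable g & N (f \- g)%R < e%:E) ->
  lipschitz_approximable f.
Proof.
move=> /Lfun2P[mf _] af; split => // e e0.
have e20 : (0 < e / 2)%R by rewrite divr_gt0.
have [g [mg ag] fg] := af _ e20; have [phi [K K0 Kphi] gphi] := ag _ e20.
have mphi := lipschitz_measurable K0 Kphi.
exists phi; first by exists K.
rewrite (_ : (_ \- _)%R = ((f \- g) \+ (g \- phi))%R); last first.
  by apply/funext => x /=; ring.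
apply: le_lt_trans; first by apply: Lnorm2D; exact: measurable_funB.
by rewrite (splitr e) (EFinD (e / 2)) lteD.
Qed.

Lemma lipschitz_approximable_open (A : set T) : open A ->
  lipschitz_approximable (\1_A : borel T -> R).
Proof.
move=> oA; have mA : measurable (A : set (borel T)) by exact: open_borel.
have [C0|/set0P C0] := eqVneq (~` A) set0.
  by rewrite (_ : A = setT) ?indicT; [exact: lipschitz_approximable_cst|
    rewrite -[A]setCK C0 setC0].
split; first exact: measurable_indic.
move=> e e0; pose D := cost_to (~` A).
have lD := cost_to_lipschitz C0.
have D0 x : (0 <= D x)%R by apply: le_cost_to => // y _; exact: cost_ge0.
have mD : measurable_fun [set: borel T] D by exact: lipschitz_measurable lD.
(* these functions vanish off A and increase to 1 on A, where cost_to (~` A)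
   is positive because A is open *)
pose phi n x := Num.min (n.+1%:R * D x)%R 1%R.
have mphi n : measurable_fun [set: borel T] (phi n).
  by apply: measurable_minr => //; exact: measurable_funM.
have phi01 n x : (0 <= phi n x <= 1)%R.
  by rewrite /phi le_min ge_min lexx orbT ler01 mulr_ge0.
have [n Ne] : exists n, N ((\1_A : borel T -> R) \- phi n)%R < e%:E.
  apply: (@Lnorm2_dominated _ _ _ Pi phi _ (cst 1%R)) => //.
  - exact: Lfun_cst.
  - move=> x; apply: cvg_near_cst; have [Ax|nAx] := pselect (A x).
      have /nbhs_ballP[r /= r0 rA] : nbhs x A by exact: open_nbhs_nbhs.
      have rD : (Num.min r 1 <= D x)%R.
        apply: le_cost_to => // y nAy; rewrite /cost /=.
        rewrite le_min !ge_min lexx orbT andbT; apply/orP; left.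
        by rewrite leNgt; apply/negP => xy; apply: nAy; apply: rA; rewrite ballEmdist.
      have Dpos : (0 < D x)%R by apply: lt_le_trans rD; rewrite lt_min r0 ltr01.
      exists (Num.truncn (D x)^-1) => // n /= nD.
      rewrite indicE mem_set// /phi min_r// -ler_pdivrMr// mul1r.
      apply: ltW; apply: lt_le_trans (truncnS_gt _) _.
      by rewrite ler_nat ltnS.
    apply: nearW => n; rewrite indicE memNset// /phi.
    have -> : D x = 0%R.
      apply/eqP; rewrite eq_le D0 andbT.
      by apply: le_trans (cost_to_le _ nAx) _; rewrite cost_diag.
    by rewrite mulr0 min_l.
  - move=> n x; have /andP[p0 p1] := phi01 n x; rewrite indicE ler_norml.
    by case: (_ \in _); rewrite /=; lra.
exists (phi n) => //; exists n.+1%:R => // x y.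
have minB (a b : R) : (`|Num.min a 1 - Num.min b 1| <= `|a - b|)%R.
  rewrite ler_norml; have := ler_norm (a - b); have := ler_norm (b - a).
  by rewrite distrC; case: (leP a 1%R); case: (leP b 1%R); lra.
apply: le_trans (minB _ _) _; rewrite -mulrBr normrM ger0_norm// ler_wpM2l//.
by have := lD x y; rewrite mul1r.
Qed.

Lemma Lfun2_lipschitz_approximable (f : borel T -> R) :
  f \in Lfun Pi 2%:E -> lipschitz_approximable f.
Proof.
apply: (@Lfun2_induction _ (borel T) R Pi (@open T)) => //.
- by move=> A B; exact: openI.
- exact: lipschitz_approximable_cst.
- by move=> k g h; exact: lipschitz_approximable_affine.
- exact: lipschitz_approximable_lim.
- exact: lipschitz_approximable_open.
Qed.

Variable P : R.-pker (borel T) ~> (borel T).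
Hypothesis revP : reversible P Pi.

(** Write f = phi + g with phi Lipschitz and g small in L2: phi obeys the gap
    inequality, and P as well as centering move g by little, so the inequality
    for f holds up to an arbitrarily small error. *)
Lemma spectral_gap_of_lipschitz (rho : R) : (0 <= rho)%R -> (rho <= 1)%R ->
  (forall K (phi : borel T -> R), (0 < K)%R -> cost_lipschitz K phi ->
    N (mop P phi \- cst (mean Pi phi))%R <= rho%:E * N (centered Pi phi)) ->
  spectral_beta P Pi <= rho%:E.
Proof.
move=> rho0 rho1 gap; apply/(spectral_betaP revP rho0) => f f2.
have /Lfun2P[mf _] := f2; have [_ af] := Lfun2_lipschitz_approximable f2.
have centeredB g h : g \in Lfun Pi 2%:E -> h \in Lfun Pi 2%:E ->
    centered Pi (g \- h)%R = (centered Pi g \- centered Pi h)%R.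
  move=> g2 h2; apply/funext => x; rewrite /centered /mean /=.
  have ig := Lfun2_integrable (probability_setT Pi) g2.
  have ih := Lfun2_integrable (probability_setT Pi) h2.
  by rewrite (RintegralB measurableT ig ih); ring.
apply/lee_addgt0Pr => e e0.
have e40 : (0 < e / 4)%R by rewrite divr_gt0.
have [phi [K K0 Kphi] fphi] := af _ e40.
have phi2 : phi \in Lfun Pi 2%:E.
  exact: Lfun2_bounded (cost_lipschitz_bounded_measurable K0 Kphi).
have h2 := Lfun2B f2 phi2; set h := (f \- phi)%R in fphi h2.
have [cf2 cphi2 ch2] := And3 (Lfun2_centered f2) (Lfun2_centered phi2) (Lfun2_centered h2).
have [/Lfun2P[mcf _] /Lfun2P[mcphi _] /Lfun2P[mch _]] := And3 cf2 cphi2 ch2.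
have /Lfun2P[mh _] := h2.
have Nch : N (centered Pi h) <= (e / 2)%:E.
  apply: le_trans; first by apply: Lnorm2B.
  rewrite (Lnorm2_cst (probability_setT Pi)).
  have meanh : `|mean Pi h|%:E <= N h.
    apply: le_trans (abse_integral_le_Lnorm2 (probability_setT Pi) mh).
    rewrite /mean EFin_normr_Rintegral//.
    exact: (Lfun2_integrable (probability_setT Pi) h2).
  apply: (@le_trans _ _ ((e / 4)%:E + (e / 4)%:E)).
    by apply: leeD; [exact: ltW|exact: le_trans meanh (ltW fphi)].
  by rewrite -EFinD lee_fin; lra.
have cphiE : centered Pi phi = (centered Pi f \- centered Pi h)%R.
  by rewrite /h centeredB//; apply/funext => x /=; ring.
have cfE : centered Pi f = (centered Pi phi \- (\- centered Pi h))%R.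
  by rewrite cphiE; apply/funext => x /=; ring.
have nch2 : (\- centered Pi h)%R \in Lfun Pi 2%:E.
  by apply/Lfun2P; split; [exact: measurableT_comp|rewrite Lnorm2N; case/Lfun2P : ch2].
rewrite Lnorm2_mop_center// cfE.
rewrite (@ae_eq_Lnorm2 _ _ _ Pi _
    (EFin \o (mop P (centered Pi phi) \- mop P (\- centered Pi h))%R)); last 3 first.
- apply/measurable_EFinP; apply: measurable_mop; apply: measurable_funB => //.
  exact: measurableT_comp.
- apply/measurable_EFinP; apply: measurable_funB; apply: measurable_mop => //.
  exact: measurableT_comp.
- by apply: filterS (ae_mopB revP cphi2 nch2) => x /= ->.
apply: le_trans.
  by apply: Lnorm2B; apply: measurable_mop => //; exact: measurableT_comp.
rewrite -cfE -(Lnorm2_mop_center revP phi2).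
apply: (@le_trans _ _ (rho%:E * (N (centered Pi f) + (e / 2)%:E) + (e / 2)%:E)).
  apply: leeD.
    apply: le_trans (gap K phi K0 Kphi) _; apply: lee_wpmul2l; rewrite ?lee_fin//.
    by rewrite cphiE; apply: le_trans; [exact: Lnorm2B|rewrite leeD2l].
  by apply: le_trans (Lnorm2_mop revP nch2) _; rewrite Lnorm2N.
rewrite muleDr ?fin_num_adde_defl// -addeA leeD2l//.
by rewrite -EFinM -EFinD lee_fin; nra.
Qed.

End lipschitz_density.

Theorem proposition2 (R : realType) (Omega : pointedMetricType R)
    (Pi : probability (borel Omega) R)
    (P : R.-pker (borel Omega) ~> (borel Omega))
    (revP : reversible P Pi)
    (rho : R) (rho_gt0 : (0 < rho)%R) (rho_lt1 : (rho < 1)%R) :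
  spectral_beta P Pi <= rho%:E
  <->
  (forall mu : probability (borel Omega) R, has_L2_density mu Pi ->
    exists2 C : R, (0 < C)%R &
      forall t : nat, (0 < t)%N ->
        wasserstein_min1 (kact mu (kiter P t)) Pi <= (C * rho ^+ t)%:E).
Proof.
split=> [gap mu mu2|conv].
  have [C C0 Ct] := spectral_gap_wasserstein revP (ltW rho_gt0) gap mu2.
  by exists C.
apply: (spectral_gap_of_lipschitz revP (ltW rho_gt0) (ltW rho_lt1)).
by move=> K phi K0 lphi; exact: lipschitz_gap revP _ K _ rho_gt0 conv K0 lphi.
Qed.
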